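(* Assume that the cardinality of the continuum $\mathfrak c=2^{\aleph_0}$ is a regular cardinal. Then there exists a unique (up to isometry) Banach space $\mathfrak X$ with the following properties: (1) $\mathrm{dens}(\mathfrak X)=\mathfrak c$; (2) $\mathfrak X$ is tightly $\sigma$-filtered; (3) for all isometric embeddings of Banach spaces $u:X\to\mathfrak X$ and $v:X\to Y$, if $\mathrm{dens}(X)<\mathfrak c$ and $v$ is posex, then there exists an isometric embedding $\tilde u:Y\to\mathfrak X$ such that $\tilde u v=u$.
   Context: Subspaces are closed linear subspaces, isometric embeddings are linear, and $\mathrm{dens}$ denotes the density character. Push-out: let $S,X$ be subspaces of a Banach space $Y$. $Y$ is the internal push-out of $S$ and $X$, written $Y=\mathbf{PO}[S,X]$, if (i) $Y=\overline{S+X}$, and (ii) $\|x+s\|=\inf\{\|x+r\|+\|s-r\|: r\in S\cap X\}$ for all $x\in X$, $s\in S$. Posex: if $X$ is a subspace of $Y$, $Y$ is a posex of $X$ if there is a separable subspace $S\subset Y$ with $Y=\mathbf{PO}[S,X]$. An isometric embedding $v:X\to Y$ is posex if $Y$ is a posex of $v(X)$. A Banach space $\mathfrak X$ is tightly $\sigma$-filtered if there exist an ordinal $\lambda$ and subspaces $\{X_\alpha:\alpha\le\lambda\}$ of $\mathfrak X$ such that $X_\alpha\subset X_\beta$ for $\alpha<\beta\le\lambda$; $X_0=0$ and $X_\lambda=\mathfrak X$; $X_{\alpha+1}$ is a posex of $X_\alpha$ for every $\alpha<\lambda$; and $X_\beta=\overline{\bigcup_{\alpha<\beta}X_\alpha}$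 for every limit ordinal $\beta\le\lambda$. *)

(* Defs.v *)
From HB Require Import structures.
From mathcomp Require Import all_boot all_order all_algebra.
From mathcomp Require Import all_classical all_reals all_analysis.
From mathcomp Require wochoice.
Import Order.TTheory GRing.Theory Num.Theory numFieldNormedType.Exports.

Set Implicit Arguments.
Unset Strict Implicit.
Unset Printing Implicit Defensive.

Local Open Scope classical_set_scope.
Local Open Scope card_scope.
Local Open Scope ring_scope.

Definition card_lt (T U : Type) (A : set T) (B : set U) : Prop :=
  A #<= B /\ ~ (B #<= A).

(* [le] well-orders [T] in the order type of the initial ordinal of |T|. *)
Definition initial_well_order (T : Type) (le : rel T) : Prop :=
  wochoice.well_order le /\
  forall a : T, card_lt [set x | ~~ le a x] [set: T].

Definition cofinal_set (T : Type) (le : rel T) (C : set T) : Prop :=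
  forall a : T, exists2 b : T, C b & le a b.

(* [T] is infinite and cf(|T|) = |T|. Initial well-orders of
   [T] exist by the well-ordering principle and are pairwise isomorphic, so the
   choice of [le] is immaterial; that every cofinal subset has full cardinality
   says that the least cardinality of a cofinal subset is |T|. *)
Definition regular_cardinal (T : Type) : Prop :=
  infinite_set [set: T] /\
  forall le : rel T, initial_well_order le ->
  forall C : set T, cofinal_set le C -> C #= [set: T].

(* [nat -> bool] has cardinality 2^aleph_0. *)
Definition continuum := nat -> bool.

(* dens(E) = |K| *)
Definition has_dens (E : topologicalType) (T : Type) (K : set T) : Prop :=
  (exists2 D : set E, dense D & D #= K) /\
  (forall D : set E, dense D -> K #<= D).

(* dens(E) < |K|: the least cardinality of a dense subset of [E] is below |K|
   iff some dense subset has cardinality below |K|. *)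
Definition dens_lt (E : topologicalType) (T : Type) (K : set T) : Prop :=
  exists2 D : set E, dense D & card_lt D K.

Definition separable_set (E : topologicalType) (S : set E) : Prop :=
  exists D : set E, [/\ countable D, D `<=` S & S `<=` closure D].

Section Banach.
Variable R : realType.

Definition isometric_embedding (X Y : completeNormedModType R)
    (f : {linear X -> Y}) : Prop :=
  forall x : X, `|f x| = `|x|.

Definition isometric (X Y : completeNormedModType R) : Prop :=
  exists2 f : {linear X -> Y}, isometric_embedding f & range f = [set: Y].

Definition subspace_of (E : completeNormedModType R) (S : set E) : Prop :=
  closed S /\ GRing.submod_closed [in S].

(* [Y = PO[S, X]], where the Banach space [Y] is itself a subspace of an
   ambient [E]; as [Y] is closed, closures in [Y] and in [E] coincide. *)
Definition pushout (E : completeNormedModType R) (Y S X : set E) : Prop :=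
  [/\ [/\ subspace_of Y, subspace_of S & subspace_of X],
      S `<=` Y /\ X `<=` Y,
      Y = closure [set s + x | s in S & x in X]
    & forall x s : E, X x -> S s ->
        `|x + s| = inf [set `|x + r| + `|s - r| | r in S `&` X]].

Definition posex (E : completeNormedModType R) (Y X : set E) : Prop :=
  exists2 S : set E, separable_set S & pushout Y S X.

Definition posex_embedding (X Y : completeNormedModType R)
    (v : {linear X -> Y}) : Prop :=
  isometric_embedding v /\ posex [set: Y] (range v).

Definition is_least (L : Type) (le : rel L) (a : L) : Prop :=
  forall b : L, le a b.

Definition is_greatest (L : Type) (le : rel L) (a : L) : Prop :=
  forall b : L, le b a.

Definition is_succ (L : Type) (le : rel L) (a b : L) : Prop :=
  ~~ le b a /\ forall c : L, ~~ le c a -> le b c.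

Definition is_limit (L : Type) (le : rel L) (b : L) : Prop :=
  ~ is_least le b /\ forall a : L, ~ is_succ le a b.

(* The index set of ordinals [alpha <= lambda] is represented by a well-ordered
   type [L] with a greatest element, i.e. of order type [lambda + 1]. *)
Definition tightly_sigma_filtered (E : completeNormedModType R) : Prop :=
  exists (L : Type) (le : rel L) (X : L -> set E),
    (wochoice.well_order le /\ exists top : L, is_greatest le top) /\
    [/\ (forall a : L, subspace_of (X a)) /\
          (forall a b : L, le a b -> X a `<=` X b),
        forall a : L, is_least le a -> X a = [set 0],
        forall a : L, is_greatest le a -> X a = [set: E],
        forall a b : L, is_succ le a b -> posex (X b) (X a)
      & forall b : L, is_limit le b ->
          X b = closure (\bigcup_(a in [set a | ~~ le b a]) X a)].

Definition extension_property (E : completeNormedModType R) : Prop :=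
  forall (X Y : completeNormedModType R)
      (u : {linear X -> E}) (v : {linear X -> Y}),
    isometric_embedding u -> posex_embedding v ->
    dens_lt X [set: continuum] ->
    exists2 w : {linear Y -> E},
      isometric_embedding w & forall x : X, w (v x) = u x.

End Banach.

(* Main.v *)
(** Uniqueness. Let S_a be the separable piece attached at step a of a filtration, and
    for a set G of indices let E(G) be the closed span of the S_a with a in G. Call G
    saturated if S_a ∩ E(< a) lies in E(G ∩ (< a)) for every a in G. Unions of saturated
    sets are saturated, every countable set lies in a countable saturated set, and
    E(G ∪ D) = PO[E(D), E(G)] for saturated G and D. Hence E(G ∪ D) is a posex of every
    space between E(G) and E(G ∪ D) that is generated by E(G) and a separable set, and the
    extension property extends partial isometries with such domains. Alternating ω times
    between two spaces gives an isometry between hulls of saturated sets again, and a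
    back-and-forth of length c exhausts dense sets; regularity of c keeps the densities of
    the intermediate domains below c.

    Existence. On the space of finitely supported functions c -> R[X] a seminorm is defined by
    recursion on c: at level a one forms a push-out with a separable extension coded by a
    countable datum. There are only c data, so each can be used cofinally often. The
    completion has the extension property because, by regularity, a subspace of density
    less than c is contained in a proper stage, after which every datum still occurs. *)

Require Import Defs.
From HB Require Import structures.
From mathcomp Require Import all_boot all_order all_algebra.
From mathcomp Require Import all_classical all_reals all_analysis.
From mathcomp Require wochoice.
From mathcomp Require Import lra.
Import Order.TTheory GRing.Theory Num.Theory numFieldNormedType.Exports.

Set Implicit Arguments.
Unset Strict Implicit.
Unset Printing Implicit Defensive.

Local Open Scope classical_set_scope.
Local Open Scope card_scope.
Local Open Scope ring_scope.

(** * Completion of a seminormed space *)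

(** The range of an extension supplied by the extension property bears no relation to the saturated
    sets of the target. All that is known of it is that it is generated by countably many vectors
    over a hull fixed beforehand. Hence push-outs must be passed to intermediate spaces, and ω
    alternations are needed before both sides are hulls again. For existence, all norms live on one
    fixed vector space, so the recursion produces real-valued functions instead of Banach spaces,
    and a single completion at the end replaces direct limits. Seminorms are allowed because a
    prescribed new vector may be at distance 0 from an old one. That there are only c data rests on
    the fact that a seminorm on R[X] x R[X] is determined by its values at pairs of rational
    polynomials. The lower bound for the density of the space comes from the extension property
    itself: a space of smaller density would have to contain a proper posex of itself, compatibly
    with the identity. *)

Lemma half_expn_lt (R : realType) (e : R) : 0 < e -> exists n, 2^-1 ^+ n < e.
Proof.
move=> e0; have [n _ /(_ n (leqnn n))] := near_infty_natSinv_expn_lt (PosNum e0).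
by rewrite /= div1r -exprVn; exists n.
Qed.

Section SeminormedQuotient.
Variables (R : realType) (W : lmodType R) (P : set W) (N : W -> R).
Hypothesis P0 : P 0.
Hypothesis PL : forall (a : R) x y, P x -> P y -> P (a *: x + y).
Hypothesis ND : forall x y, P x -> P y -> N (x + y) <= N x + N y.
Hypothesis NZ : forall (a : R) x, P x -> N (a *: x) = `|a| * N x.
Hypothesis Ncomplete : forall u : nat -> W, (forall n, P (u n)) ->
  (forall n m, (n <= m)%N -> N (u n - u m) <= 2^-1 ^+ n) ->
  exists2 l, P l & forall e, 0 < e -> exists n0, forall n, (n0 <= n)%N -> N (u n - l) < e.

Let PD x y : P x -> P y -> P (x + y).
Proof. by move=> Px Py; have := PL 1 Px Py; rewrite scale1r. Qed.
Let PZ a x : P x -> P (a *: x).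
Proof. by move=> Px; have := PL a Px P0; rewrite addr0. Qed.
Let PN x : P x -> P (- x).
Proof. by move=> Px; rewrite -scaleN1r; exact: PZ. Qed.
Let PB x y : P x -> P y -> P (x - y).
Proof. by move=> Px Py; apply: PD => //; exact: PN. Qed.
Let N0 : N 0 = 0.
Proof. by rewrite -(scale0r (0 : W)) NZ// normr0 mul0r. Qed.
Let NN x : P x -> N (- x) = N x.
Proof. by move=> Px; rewrite -scaleN1r NZ// normrN normr1 mul1r. Qed.
Let N_ge0 x : P x -> 0 <= N x.
Proof.
by move=> Px; have := ND Px (PN Px); rewrite subrr N0 NN// => ?; lra.
Qed.

Let eqv x y := P y /\ N (x - y) = 0.

Let eqvxx x : P x -> eqv x x.
Proof. by move=> Px; split; rewrite ?subrr. Qed.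
Let eqv_sym x y : P x -> eqv x y -> eqv y x.
Proof. by move=> Px [Py e]; split=> //; rewrite -opprB NN//; exact: PB. Qed.
Let eqv_trans x y z : P x -> eqv x y -> eqv y z -> eqv x z.
Proof.
move=> Px [Py xy] [Pz yz]; split=> //; apply/eqP; rewrite eq_le N_ge0 ?andbT; last exact: PB.
rewrite -[x](subrK y) -addrA; apply: le_trans (ND _ _) _; try exact: PB.
by rewrite xy yz addr0.
Qed.
Let eqvD x y x' y' : P x -> P y -> eqv x x' -> eqv y y' -> eqv (x + y) (x' + y').
Proof.
move=> Px Py [Px' xx'] [Py' yy']; split; first exact: PD.
apply/eqP; rewrite eq_le N_ge0 ?andbT; last by apply: PB; exact: PD.
rewrite opprD addrACA; apply: le_trans (ND _ _) _; try exact: PB.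
by rewrite xx' yy' addr0.
Qed.
Let eqvZ a x x' : P x -> eqv x x' -> eqv (a *: x) (a *: x').
Proof.
move=> Px [Px' xx']; split; first exact: PZ.
by rewrite -scalerBr NZ ?xx' ?mulr0//; exact: PB.
Qed.

(* Points of the quotient are the vectors that are their own chosen representative, so the
   quotient is a subtype of W and no quotient type is needed. *)
Let rep x := xget 0 (eqv x).
Let repP x : P x -> eqv x (rep x).
Proof. by move=> Px; rewrite /rep; case: xgetP => [y -> //|/(_ x)]; have := eqvxx Px. Qed.
Let P_rep x : P x -> P (rep x).
Proof. by move/repP => []. Qed.
Let rep_eqv x y : P x -> eqv x y -> rep x = rep y.
Proof.
move=> Px xy; congr xget; apply/funext => z; apply/propext; split.
  by apply: eqv_trans; [case: xy|exact: eqv_sym].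
exact: eqv_trans.
Qed.

Let inQ : pred W := fun x => `[< P x /\ rep x = x >].
Let Q := {x : W | inQ x}.

Let inQ_rep x : P x -> inQ (rep x).
Proof.
move=> Px; apply/asboolP; split; first exact: P_rep.
by apply/esym/rep_eqv => //; exact: repP.
Qed.
Let PQ (x : Q) : P (val x).
Proof. by have /asboolP[] := valP x. Qed.
Let pi (x : W) : Q := insubd (exist inQ (rep 0) (inQ_rep P0)) (rep x).
Let val_pi x : P x -> val (pi x) = rep x.
Proof. by move=> Px; rewrite val_insubd inQ_rep. Qed.
Let piP x : P x -> eqv x (val (pi x)).
Proof. by move=> Px; rewrite val_pi//; exact: repP. Qed.
Let val_piK x : pi (val x) = x.
Proof. by apply/val_inj; rewrite val_pi//; have /asboolP[] := valP x. Qed.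
Let pi_eqv x y : P x -> eqv x y -> pi x = pi y.
Proof. by move=> Px xy; rewrite /pi (rep_eqv Px xy). Qed.

Let qadd (x y : Q) := pi (val x + val y).
Let qopp (x : Q) := pi (- val x).
Let qscale (a : R) (x : Q) := pi (a *: val x).
Let piD x y : P x -> P y -> pi (x + y) = qadd (pi x) (pi y).
Proof. by move=> Px Py; apply: pi_eqv; [exact: PD|apply: eqvD => //; exact: piP]. Qed.
Let piZ a x : P x -> pi (a *: x) = qscale a (pi x).
Proof. by move=> Px; apply: pi_eqv; [exact: PZ|apply: eqvZ => //; exact: piP]. Qed.
Let ind (K : Q -> Prop) : (forall x, P x -> K (pi x)) -> forall x, K x.
Proof. by move=> H x; rewrite -[x]val_piK; exact: H. Qed.
Let qaddA : associative qadd.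
Proof.
elim/ind => x Px; elim/ind => y Py; elim/ind => z Pz.
by rewrite -!piD// ?addrA//; exact: PD.
Qed.
Let qaddC : commutative qadd.
Proof. by elim/ind => x Px; elim/ind => y Py; rewrite -!piD// addrC. Qed.
Let qadd0 : left_id (pi 0) qadd.
Proof. by elim/ind => x Px; rewrite -!piD// add0r. Qed.
Let qaddN : left_inverse (pi 0) qopp qadd.
Proof.
move=> x; rewrite /qopp -[X in qadd _ X]val_piK -piD ?addNr//; first exact: PN.
Qed.
HB.instance Definition _ := [Choice of Q by <:].
HB.instance Definition _ := GRing.isZmodule.Build Q qaddA qaddC qadd0 qaddN.

Let qscaleA a b v : qscale a (qscale b v) = qscale (a * b) v.
Proof. by elim/ind: v => x Px; rewrite -!piZ ?scalerA//; exact: PZ. Qed.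
Let qscale1 : left_id 1 qscale.
Proof. by elim/ind => x Px; rewrite -piZ// scale1r. Qed.
Let qscaleDr : right_distributive qscale +%R.
Proof.
move=> a; elim/ind => x Px; elim/ind => y Py; rewrite -[pi x + pi y]piD// -!piZ//; last exact: PD.
by rewrite scalerDr piD//; exact: PZ.
Qed.
Let qscaleDl v : {morph qscale^~ v : a b / a + b}.
Proof. by elim/ind: v => x Px a b; rewrite -!piZ// scalerDl piD//; exact: PZ. Qed.
HB.instance Definition _ := GRing.Zmodule_isLmodule.Build R Q qscaleA qscale1 qscaleDr qscaleDl.

Let qnorm (x : Q) : R := N (val x).
Let qnorm_pi x : P x -> qnorm (pi x) = N x.
Proof.
move=> Px; have [Py e] := piP Px; set y := val _ in Py e.
have := ND (PB Px Py) Py; have := ND (PN (PB Px Py)) Px.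
by rewrite NN ?e ?opprB ?subrK ?add0r /qnorm -?/y; [lra|exact: PB].
Qed.
Let qnormD x y : qnorm (x + y) <= qnorm x + qnorm y.
Proof.
elim/ind: x => x Px; elim/ind: y => y Py; rewrite -[_ + _]piD// !qnorm_pi//; last exact: PD.
exact: ND.
Qed.
Let qnormZ (l : R) x : qnorm (l *: x) = `|l| * qnorm x.
Proof.
by elim/ind: x => x Px; rewrite -[_ *: _]piZ// !qnorm_pi// ?NZ//; exact: PZ.
Qed.
Let qnorm0 x : qnorm x = 0 -> x = 0.
Proof.
elim/ind: x => x Px; rewrite qnorm_pi// => Nx; apply: pi_eqv => //.
by split=> //; rewrite ?subr0.
Qed.
HB.instance Definition _ := Lmodule_isNormed.Build R Q qnormD qnormZ qnorm0.

Let piB x y : P x -> P y -> `|pi x - pi y| = N (x - y).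
Proof.
move=> Px Py; have -> : - pi y = pi (- y) by rewrite -[in RHS]scaleN1r piZ// -[LHS]scaleN1r.
by rewrite -[_ + _]piD ?[LHS]qnorm_pi//; [exact: PB|exact: PN].
Qed.

Let Qcomplete (F : set_system Q) : ProperFilter F -> cauchy F -> cvg F.
Proof.
move=> FF /cauchy_ballP Fc; apply/cvg_ex.
have diam n : exists A, F A /\ forall x y, A x -> A y -> `|x - y| < 2^-1 ^+ n.
  have [|[A B]/= [FA FB] AB] := Fc (2^-1 ^+ n); first by rewrite exprn_gt0// invr_gt0.
  exists (A `&` B); split; first exact: filterI.
  by move=> x y [Ax _] [_ By]; have := AB (x, y) (conj Ax By); rewrite -ball_normE.
have [A /all_and2[FA Ad]] := choice diam.
(* Choosing [u n] in the first n + 1 sets puts both [u n] and [u m] in [A n] whenever n <= m, which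
   gives the geometric rate demanded by [Ncomplete]. *)
have inter n : F [set x | forall k, (k <= n)%N -> A k x].
  elim: n => [|n IH]; first by apply: filterS (FA 0) => x Ax k; rewrite leqn0 => /eqP ->.
  apply: filterS (filterI IH (FA n.+1)) => x [IHx Ax] k.
  by rewrite leq_eqVlt => /predU1P[->//|]; rewrite ltnS => /IHx.
have [u uA] := choice (fun n => filter_ex (inter n)).
have [||l Pl ul] := Ncomplete (u := fun n => val (u n)) => // [n m nm|].
  by rewrite -piB// !val_piK; apply/ltW/Ad; exact: uA.
exists (pi l); apply/cvgrPdist_lt => e e0.
have e20 : 0 < e / 2 by rewrite divr_gt0.
have [n0 n0P] := ul _ e20.
have [n1 n1P] := half_expn_lt e20.
pose n := maxn n0 n1; apply: filterS (FA n) => x Ax.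
have lu : `|pi l - u n| < e / 2.
  by rewrite distrC -[u n]val_piK piB// n0P// leq_maxl.
have ux : `|u n - x| < e / 2.
  apply: le_lt_trans n1P; apply/ltW/(lt_le_trans (Ad _ _ _ (uA n _ (leqnn n)) Ax)).
  by rewrite ler_wiXn2l ?leq_maxr ?invr_ge0 ?invf_le1 ?ler1n.
have := ler_normD (pi l - u n) (u n - x); rewrite addrA subrK; lra.
Qed.
HB.instance Definition _ := Uniform_isComplete.Build Q Qcomplete.

(** Stated relative to a linear subset [P] of an ambient module, so that one construction serves two
    purposes: completing a space ([P] the Cauchy sequences) and turning a closed subspace into a
    type of its own ([P] the subspace). *)
Lemma seminormed_quotient : exists (E : completeNormedModType R) (j : W -> E),
  [/\ forall (a : R) x y, P x -> P y -> j (a *: x + y) = a *: j x + j y,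
      forall x, P x -> `|j x| = N x & forall e, exists2 x, P x & j x = e].
Proof.
exists Q, pi; split => [a x y Px Py|x Px|e].
- by rewrite piD ?piZ//; exact: PZ.
- exact: qnorm_pi.
- by exists (val e) => //; exact: val_piK.
Qed.
End SeminormedQuotient.

Section Linear.
Variables (R : realType) (W : lmodType R).
Implicit Types (P : set W) (N : W -> R).

Definition linear_set P := P 0 /\ forall (a : R) x y, P x -> P y -> P (a *: x + y).

Lemma linear_setD P x y : linear_set P -> P x -> P y -> P (x + y).
Proof. by move=> [_ PL] Px Py; have := PL 1 _ _ Px Py; rewrite scale1r. Qed.

Lemma linear_setZ P a x : linear_set P -> P x -> P (a *: x).
Proof. by move=> [P0 PL] Px; have := PL a _ _ Px P0; rewrite addr0. Qed.

Lemma linear_setN P x : linear_set P -> P x -> P (- x).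
Proof. by move=> lP Px; rewrite -scaleN1r; exact: linear_setZ. Qed.

Lemma linear_setB P x y : linear_set P -> P x -> P y -> P (x - y).
Proof. by move=> lP Px Py; apply: linear_setD => //; exact: linear_setN. Qed.

Lemma linear_set_sum P n (f : nat -> W) :
  linear_set P -> (forall i, P (f i)) -> P (\sum_(i < n) f i).
Proof.
move=> lP Pf; elim/big_ind : _ => //; first exact: lP.1.
by move=> x y; exact: linear_setD.
Qed.

Definition seminorm_on P N :=
  (forall x y, P x -> P y -> N (x + y) <= N x + N y) /\
  (forall (a : R) x, P x -> N (a *: x) = `|a| * N x).

Section Seminorm.
Variables (P : set W) (N : W -> R).
Hypotheses (lP : linear_set P) (sN : seminorm_on P N).

Lemma seminorm0 : N 0 = 0.
Proof. by have := sN.2 0 _ lP.1; rewrite scale0r normr0 mul0r. Qed.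

Lemma seminormN x : P x -> N (- x) = N x.
Proof. by move=> Px; rewrite -scaleN1r sN.2// normrN normr1 mul1r. Qed.

Lemma seminorm_ge0 x : P x -> 0 <= N x.
Proof.
move=> Px; have := sN.1 _ _ Px (linear_setN lP Px).
by rewrite subrr seminorm0 seminormN// => ?; lra.
Qed.

Lemma seminormB x y : P x -> P y -> N (x - y) <= N x + N y.
Proof.
by move=> Px Py; rewrite -(seminormN Py); apply: sN.1 => //; exact: linear_setN.
Qed.

Lemma seminorm_distC x y : P x -> P y -> N (x - y) = N (y - x).
Proof. by move=> Px Py; rewrite -opprB seminormN//; exact: linear_setB. Qed.

Lemma seminorm_triangle z x y : P x -> P y -> P z -> N (x - y) <= N (x - z) + N (z - y).
Proof.
move=> Px Py Pz; have := sN.1 _ _ (linear_setB lP Px Pz) (linear_setB lP Pz Py).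
by rewrite addrA subrK.
Qed.

Lemma seminorm_le x y : P x -> P y -> N x <= N (x - y) + N y.
Proof.
by move=> Px Py; have := sN.1 _ _ (linear_setB lP Px Py) Py; rewrite subrK.
Qed.

Lemma seminorm_dist x y : P x -> P y -> `|N x - N y| <= N (x - y).
Proof.
move=> Px Py; have := seminorm_le Px Py; have := seminorm_le Py Px.
by rewrite (seminorm_distC Py Px) ler_norml => ? ?; apply/andP; split; lra.
Qed.
End Seminorm.
End Linear.

Section Completion.
Variables (R : realType) (W : lmodType R) (P : set W) (N : W -> R).
Hypotheses (lP : linear_set P) (sN : seminorm_on P N).

Let cauchy_in : set (nat -> W) := [set u | (forall n, P (u n)) /\
  forall e, 0 < e -> exists n0, forall n m, (n0 <= n)%N -> (n0 <= m)%N -> N (u n - u m) < e].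

Let limN (u : nat -> W) : R := limn (N \o u).

Let linear_cauchy : linear_set cauchy_in.
Proof.
split; first by split=> [n|e e0]; [exact: lP.1|exists 0%N => n m _ _; rewrite subrr (seminorm0 lP sN)].
move=> a u v [Pu cu] [Pv cv]; split=> [n|e e0]; first exact: lP.2.
have a0 : 0 < `|a| + 1 by rewrite ltr_wpDl.
have e20 : 0 < e / 2 by rewrite divr_gt0.
have [n0 n0P] := cu _ (divr_gt0 e20 a0); have [n1 n1P] := cv _ e20.
exists (maxn n0 n1) => n m; rewrite !geq_max => /andP[h1 h2] /andP[h3 h4].
have -> : (a *: u + v) n - (a *: u + v) m = a *: (u n - u m) + (v n - v m).
  by rewrite /= scalerBr !fctE opprD addrACA.
apply: le_lt_trans (sN.1 _ _ _ _) _; [|exact: linear_setB|].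
  by apply: linear_setZ => //; exact: linear_setB.
rewrite sN.2; last exact: linear_setB.
have := n1P n m h2 h4; have := n0P n m h1 h3.
rewrite ltr_pdivlMr// => H1 H2.
have : 0 <= N (u n - u m) by apply: (seminorm_ge0 lP sN); exact: linear_setB.
by move: H1 H2; lra.
Qed.

Let limNP u : cauchy_in u -> N (u n) @[n --> \oo] --> limN u.
Proof.
move=> [Pu cu]; apply/cauchy_cvgP/cauchy_ballP => e e0.
have [n0 n0P] := cu e e0.
exists ([set x | exists2 n, (n0 <= n)%N & x = N (u n)], [set x | exists2 n, (n0 <= n)%N & x = N (u n)]).
  by split; exists n0 => // n /= ?; exists n.
move=> [_ _] /= [[n n0n ->] [m n0m ->]]; rewrite -ball_normE /=.
by apply: le_lt_trans (seminorm_dist lP sN _ _) (n0P _ _ _ _).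
Qed.

Let limN_le u c : cauchy_in u -> (exists n0, forall n, (n0 <= n)%N -> N (u n) <= c) -> limN u <= c.
Proof.
move=> /limNP cu [n0 n0P]; apply: limr_le; first by apply/cvg_ex; exists (limN u).
by exists n0 => // n /= ?; exact: n0P.
Qed.

Let limN_seminorm : seminorm_on cauchy_in limN.
Proof.
split=> [u v cu cv|a u cu].
  have cuv : cauchy_in (u + v) by apply: linear_setD.
  apply: ler_cvg_to (limNP cuv) (cvgD (limNP cu) (limNP cv)) _.
  by near=> n; apply: sN.1; [exact: cu.1|exact: cv.1].
apply/cvg_lim => //.
rewrite (_ : N \o _ = fun n => `|a| * N (u n)); last first.
  by apply/funext => n /=; rewrite sN.2//; exact: cu.1.
by apply: cvgMr; exact: limNP.
Unshelve. all: by end_near. Qed.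

Let limN_gt u e : cauchy_in u -> 0 < e -> exists n0, forall n, (n0 <= n)%N -> N (u n) < limN u + e.
Proof.
move=> /limNP/cvgrPdist_lt/[apply] -[n0 _ n0P]; exists n0 => n /n0P /=.
by rewrite ltr_distlC => /andP[].
Qed.

(** Diagonal argument: [nu k] is an index beyond which [u k] oscillates by less than 2^-k, and the
    limit is the sequence of the [u k (nu k)]. *)
Let limN_complete (u : nat -> (nat -> W)) : (forall n, cauchy_in (u n)) ->
  (forall n m, (n <= m)%N -> limN (u n - u m) <= 2^-1 ^+ n) ->
  exists2 l, cauchy_in l & forall e, 0 < e -> exists n0, forall n, (n0 <= n)%N -> limN (u n - l) < e.
Proof.
move=> cu ucau.
have h0 k : 0 < 2^-1 ^+ k :> R by rewrite exprn_gt0// invr_gt0.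
have [nu nuP] := choice (fun k => (cu k).2 _ (h0 k)).
pose d k := u k (nu k).
have Pu k n : P (u k n) by exact: (cu k).1.
have Pd k : P (d k) by exact: Pu.
have hle k m : (k <= m)%N -> 2^-1 ^+ m <= 2^-1 ^+ k :> R.
  by move=> km; rewrite ler_wiXn2l ?invr_ge0 ?invf_le1 ?ler1n.
(* The factor 4 collects the oscillations of [u k] and [u m], their distance for the limit seminorm,
   and the error of reading that distance at a single index [p]. *)
have dd k m : (k <= m)%N -> N (d k - d m) <= 4 * 2^-1 ^+ k.
  move=> km.
  have [n0 n0P] := limN_gt (linear_setB linear_cauchy (cu k) (cu m)) (h0 k).
  pose p := maxn n0 (maxn (nu k) (nu m)).
  have := n0P p (leq_maxl _ _); have := ucau _ _ km.
  have := nuP k (nu k) p (leqnn _) ltac:(by rewrite !leq_max leqnn ?orbT).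
  have := nuP m p (nu m) ltac:(by rewrite !leq_max leqnn ?orbT) (leqnn _).
  have := seminorm_triangle lP sN (Pd k) (Pd m) (Pu k p).
  have := seminorm_triangle lP sN (Pu k p) (Pd m) (Pu m p).
  have := hle _ _ km; rewrite /= !fctE -/(d k) -/(d m); lra.
have cd : cauchy_in d.
  split=> // e e0; have [n0 n0P] := half_expn_lt (divr_gt0 e0 (ltac:(lra) : 0 < 8 :> R)).
  have aux n m : (n0 <= n)%N -> (n <= m)%N -> N (d n - d m) < e.
    by move=> h1 h2; have := dd _ _ h2; have := hle _ _ h1; lra.
  exists n0 => n m hn hm; have [nm|/ltnW mn] := leqP n m; first exact: aux.
  by rewrite (seminorm_distC lP sN)//; exact: aux.
exists d => // e e0; have [n0 n0P] := half_expn_lt (divr_gt0 e0 (ltac:(lra) : 0 < 6 :> R)).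
exists n0 => k hk; suff : limN (u k - d) <= 5 * 2^-1 ^+ k by have := hle _ _ hk; have := h0 n0; lra.
apply: limN_le; first exact: linear_setB.
exists (maxn (nu k) k) => p; rewrite geq_max => /andP[hp kp].
have := nuP k p (nu k) hp (leqnn _); have := dd _ _ kp.
by have := seminorm_triangle lP sN (Pu k p) (Pd p) (Pd k); rewrite /= !fctE -/(d k); lra.
Qed.

(** Cauchy sequences are complete for the limit of the seminorms; the quotient by the null sequences
    is the completion, and the constant sequences have dense image. *)
Lemma seminorm_completion : exists (E : completeNormedModType R) (j : W -> E),
  [/\ forall (a : R) x y, P x -> P y -> j (a *: x + y) = a *: j x + j y,
      forall x, P x -> `|j x| = N x
    & forall z e, 0 < e -> exists2 x, P x & `|z - j x| < e].
Proof.
have [E [j [jL jN js]]] := seminormed_quotient linear_cauchy.1 linear_cauchy.2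
  limN_seminorm.1 limN_seminorm.2 limN_complete.
have cst x : P x -> cauchy_in (fun=> x).
  by move=> Px; split=> // e e0; exists 0%N => n m _ _; rewrite subrr (seminorm0 lP sN).
exists E, (fun x => j (fun=> x)); split=> [a x y Px Py|x Px|z e e0].
- by rewrite -jL//; exact: cst.
- by rewrite jN; [apply/cvg_lim => //; exact: cvg_cst|exact: cst].
have [u cu <-] := js z; have e20 : 0 < e / 2 by rewrite divr_gt0.
have [n0 n0P] := cu.2 _ e20.
have Pn := cu.1 n0; exists (u n0) => //.
have -> : j u - j (fun=> u n0) = j (u - fun=> u n0).
  by rewrite addrC -scaleN1r -jL ?scaleN1r 1?addrC//; exact: cst.
rewrite jN; last by apply: (linear_setB linear_cauchy) => //; exact: cst.
apply: le_lt_trans (_ : e / 2 < e); last by lra.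
apply: limN_le; first by apply: (linear_setB linear_cauchy) => //; exact: cst.
by exists n0 => n h; apply/ltW/n0P.
Qed.
End Completion.

(** * Closed spans and isometric graphs *)

Section LinearCombination.
Variables (R : realType) (A : nzRingType) (f : {rmorphism A -> R}) (W : lmodType R) (d : nat -> W).

Implicit Types p q : {poly A}.

(** A polynomial serves only as a finitely supported coefficient sequence. The morphism [f] is
    [ratr] where countability is wanted and the identity where all real combinations are. *)
Definition lincomb (p : {poly A}) : W := \sum_(i < size p) f p`_i *: d i.

Lemma lincomb_wide n p : (size p <= n)%N -> lincomb p = \sum_(i < n) f p`_i *: d i.
Proof.
move=> pn; rewrite /lincomb (big_ord_widen _ (fun i => f p`_i *: d i) pn) big_mkcond /=.
by apply: eq_bigr => i _; case: ltnP => // h; rewrite nth_default// rmorph0 scale0r.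
Qed.

Lemma lincombP a p q : lincomb (a *: p + q) = f a *: lincomb p + lincomb q.
Proof.
pose n := maxn (size (a *: p + q)%R) (maxn (size p) (size q)).
rewrite !(@lincomb_wide n) ?leq_max ?leqnn ?orbT// scaler_sumr -big_split /=.
by apply: eq_bigr => i _; rewrite coefD coefZ rmorphD rmorphM scalerDl scalerA.
Qed.

Lemma lincomb0 : lincomb 0 = 0.
Proof. by rewrite /lincomb size_poly0 big_ord0. Qed.

Lemma lincombX i : lincomb 'X^i = d i.
Proof.
rewrite (@lincomb_wide i.+1) ?size_polyXn// big_ord_recr big1 /=.
  by rewrite coefXn eqxx rmorph1 scale1r add0r.
by move=> j _; rewrite coefXn ltn_eqF// rmorph0 scale0r.
Qed.
End LinearCombination.

Lemma countable_range (T : choiceType) (x0 : T) (D : set T) :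
  countable D -> exists d : nat -> T, forall x, D x -> exists n, d n = x.
Proof.
move=> /countable_injP[f finj].
exists (fun n => xget x0 [set x | D x /\ f x = n]) => x Dx; exists (f x).
case: (xgetP _ [set y | D y /\ f y = f x]) => [y -> [Dy fxy]|/(_ x)]; last by case.
by apply: finj; rewrite ?inE.
Qed.

Section Metric.
Variables (R : realType) (E : completeNormedModType R).
Implicit Types (A B F S : set E) (x y z : E).

Lemma closure_normP A x :
  closure A x <-> forall e, 0 < e -> exists2 a, A a & `|x - a| < e.
Proof.
split=> [clA e e0|H B /nbhs_ballP[e e0 eB]].
  have [a [Aa]] := clA _ (nbhsx_ballx x e e0).
  by rewrite -ball_normE; exists a.
have [a Aa xa] := H e e0; exists a; split=> //; apply: eB.
by rewrite -ball_normE.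
Qed.

Lemma cauchy_limit (u : nat -> E) :
  (forall e, 0 < e -> exists n0, forall n m, (n0 <= n)%N -> (n0 <= m)%N -> `|u n - u m| < e) ->
  exists l, forall e, 0 < e -> exists n0, forall n, (n0 <= n)%N -> `|l - u n| < e.
Proof.
move=> cu; have : cauchy (u n @[n --> \oo]).
  apply/cauchy_ballP => e e0; have [n0 n0P] := cu e e0.
  exists ([set x | exists2 n, (n0 <= n)%N & x = u n], [set x | exists2 n, (n0 <= n)%N & x = u n]).
    by split; exists n0 => // n /= ?; exists n.
  by move=> [_ _] /= [[n n0n ->] [m n0m ->]]; rewrite -ball_normE /=; exact: n0P.
move=> /cauchy_cvgP/cvg_ex[l /cvgrPdist_lt ul]; exists l => e e0.
by have [n0 _ n0P] := ul e e0; exists n0 => n /n0P.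
Qed.

Lemma subspace_ofP F : subspace_of F <-> closed F /\ linear_set F.
Proof.
have inF x : (x \in [in F]) = (x \in F) by [].
split=> -[cF [F0 FL]]; split=> //; split.
- by rewrite inF in_setE in F0.
- by move=> a x y Fx Fy; have := FL a x y; rewrite !inF !in_setE; apply.
- by rewrite inF in_setE.
- by move=> a x y; rewrite !inF !in_setE; exact: FL.
Qed.

Lemma subspace_linear F : subspace_of F -> linear_set F.
Proof. by move=> /subspace_ofP[]. Qed.

Lemma subspace_closureP F x : subspace_of F ->
  (forall e, 0 < e -> exists2 a, F a & `|x - a| < e) -> F x.
Proof. by move=> [cF _] H; apply: cF; apply/closure_normP. Qed.

Lemma sub_closure_subspace A F : subspace_of F -> A `<=` F -> closure A `<=` F.
Proof. by move=> [cF _] AF; rewrite (closure_id F).1//; exact: closureS. Qed.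

Lemma closure_subspace A : linear_set A -> subspace_of (closure A).
Proof.
move=> lA; apply/subspace_ofP; split; first exact: closed_closure.
split; first by apply: subset_closure; exact: lA.1.
move=> a x y /closure_normP clx /closure_normP cly; apply/closure_normP => e e0.
have a0 : 0 < `|a| + 1 by rewrite ltr_wpDl.
have e20 : 0 < e / 2 by rewrite divr_gt0.
have [x' Ax' xx'] := clx _ (divr_gt0 e20 a0); have [y' Ay' yy'] := cly _ e20.
exists (a *: x' + y'); first exact: lA.2.
have -> : a *: x + y - (a *: x' + y') = a *: (x - x') + (y - y').
  by rewrite scalerBr opprD addrACA.
apply: le_lt_trans (ler_normD _ _) _; rewrite normrZ.
move: xx'; rewrite ltr_pdivlMr// => xx'.
by have := normr_ge0 (x - x'); move: xx' yy'; lra.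
Qed.

Lemma subspaceT : subspace_of [set: E].
Proof. by apply/subspace_ofP; split; [exact: closedT|]. Qed.

Definition sumset A B := [set s + x | s in A & x in B].

Lemma linear_sumset A B : linear_set A -> linear_set B -> linear_set (sumset A B).
Proof.
move=> lA lB; split; first by exists 0; [exact: lA.1|exists 0; [exact: lB.1|rewrite addr0]].
move=> a _ _ [s As [x Bx <-]] [s' As' [x' Bx' <-]].
exists (a *: s + s'); first exact: lA.2.
by exists (a *: x + x'); [exact: lB.2|rewrite scalerDr addrACA].
Qed.

Definition cspan A : set E := [set x | forall F, subspace_of F -> A `<=` F -> F x].

Lemma sub_cspan A : A `<=` cspan A.
Proof. by move=> x Ax F _; apply. Qed.

Lemma cspan_min A F : subspace_of F -> A `<=` F -> cspan A `<=` F.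
Proof. by move=> sF AF x; exact. Qed.

Lemma cspan_subspace A : subspace_of (cspan A).
Proof.
apply/subspace_ofP; split; last first.
  split; first by move=> F /subspace_linear[].
  by move=> a x y cx cy F sF AF; apply: (subspace_linear sF).2; [exact: cx|exact: cy].
move=> x clx F sF AF; apply: (subspace_closureP sF) => e e0.
by have /closure_normP/(_ e e0)[a ca xa] := clx; exists a => //; exact: ca.
Qed.

Lemma cspanS A B : A `<=` B -> cspan A `<=` cspan B.
Proof. by move=> AB; apply: cspan_min; [exact: cspan_subspace|move=> x /AB; exact: sub_cspan]. Qed.

(** The rational combinations of an enumeration are countably many, and their closure is already
    stable under real scalars: moving a scalar to a nearby rational costs a multiple of the norm of
    the vector. *)
Lemma separable_cspan A : countable A -> separable_set (cspan A).
Proof.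
move=> /(countable_range 0)[d dA].
(* The enumeration may take values outside [A]; replacing these by 0 keeps all combinations inside
   the span. *)
pose d' n := if `[< A (d n) >] then d n else 0.
pose c (p : {poly rat}) := lincomb (@ratr R) d' p.
have d'c n : cspan A (d' n).
  rewrite /d'; case: asboolP => [/sub_cspan //|_].
  exact: (subspace_linear (cspan_subspace A)).1.
exists (range c); split; first by apply: card_le_trans (countableP [set: {poly rat}]); exact: card_image_le.
  move=> _ [p _ <-]; apply: (@linear_set_sum _ _ (cspan A) _ (fun i => ratr p`_i *: d' i)).
    exact: (subspace_linear (cspan_subspace A)).
  by move=> i; apply: (linear_setZ _ (subspace_linear (cspan_subspace A))).
apply: cspan_min => [|x /[dup] Ax /dA[n dn]]; last first.
  apply: subset_closure; exists 'X^n => //; rewrite /c lincombX /d' dn.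
  by case: asboolP.
apply/subspace_ofP; split; first exact: closed_closure.
split; first by apply: subset_closure; exists 0; rewrite // /c lincomb0.
move=> a x y /closure_normP clx /closure_normP cly; apply/closure_normP => e e0.
have a0 : 0 < `|a| + 1 by rewrite ltr_wpDl.
have e40 : 0 < e / 4 by rewrite divr_gt0.
have [_ [p _ <-] xx'] := clx _ (divr_gt0 e40 a0); have [_ [q _ <-] yy'] := cly _ e40.
have c0 : 0 < `|c p| + 1 by rewrite ltr_wpDl.
have [r /andP[ar ra]] : exists r : rat, a < ratr r < a + e / 4 / (`|c p| + 1).
  have [|r] := @rat_in_itvoo R a (a + e / 4 / (`|c p| + 1)); first by rewrite ltrDl divr_gt0.
  by rewrite in_itv /=; exists r.
exists (c (r *: p + q)); first by exists (r *: p + q).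
rewrite /c lincombP -/(c p) -/(c q).
have -> : a *: x + y - (ratr r *: c p + c q) = a *: (x - c p) + (a - ratr r) *: c p + (y - c q).
  by rewrite scalerBr scalerBl [X in _ = X + _]addrA subrK opprD addrACA.
apply: le_lt_trans (ler_normD _ _) _.
have H1 : `|a *: (x - c p) + (a - ratr r) *: c p| <= `|a| * `|x - c p| + (ratr r - a) * `|c p|.
  apply: le_trans (ler_normD _ _) _; rewrite !normrZ (distrC a) (gtr0_norm (_ : 0 < ratr r - a))//.
  by rewrite subr_gt0.
have H2 : (ratr r - a) * (`|c p| + 1) < e / 4.
  by rewrite -ltr_pdivlMr// ltrBlDl.
move: xx'; rewrite ltr_pdivlMr// => xx'.
have := normr_ge0 (x - c p); have : 0 < ratr r - a by rewrite subr_gt0.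
by move: H1 H2 xx' yy'; lra.
Qed.

(** A countable dense subset of [S] may miss [A]. For each of its points d and each n, a point of
    [A] within 2^-n of d is picked if there is one; the intersection with [A] filters the default
    values. *)
Lemma separable_subset S A : separable_set S -> A `<=` S -> separable_set A.
Proof.
move=> [D [cD DS SD]] AS.
pose p (dn : E * nat) := xget 0 [set x | A x /\ `|dn.1 - x| < 2^-1 ^+ dn.2].
exists (A `&` p @` (D `*` [set: nat])); split; last 1 first.
- move=> x Ax; apply/closure_normP => e e0.
  have [n hn] := half_expn_lt (divr_gt0 e0 (ltac:(lra) : 0 < 2 :> R)).
  have h0 : 0 < 2^-1 ^+ n :> R by rewrite exprn_gt0// invr_gt0.
  have /closure_normP/(_ _ h0)[d Dd xd] := SD _ (AS _ Ax).
  have : A (p (d, n)) /\ `|d - p (d, n)| < 2^-1 ^+ n.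
    by rewrite /p; case: xgetP => [y -> //|/(_ x)]; rewrite /= distrC; case.
  move=> [Ap dp]; exists (p (d, n)); first by split=> //; exists (d, n).
  by have := ler_normD (x - d) (d - p (d, n)); rewrite addrA subrK; lra.
- apply: sub_countable (subset_card_le (@subIsetr _ _ _)) _.
  apply: sub_countable (card_image_le _ _) _.
  by apply: countableX => //; exact: countableP.
- exact: subIsetl.
Qed.
End Metric.

Section Graph.
Variables (R : realType) (X Y : completeNormedModType R).
Implicit Types (G H : X -> Y -> Prop).

(* Partial isometries are handled as linear relations, which makes inverses, unions of chains
   and closures immediate. *)
Definition isometric_graph G := [/\ G 0 0,
  forall (a : R) x y x' y', G x y -> G x' y' -> G (a *: x + x') (a *: y + y')
  & forall x y, G x y -> `|x| = `|y|].

Definition dom G : set X := [set x | exists y, G x y].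

Definition closure_graph G : X -> Y -> Prop := fun x y =>
  forall e, 0 < e -> exists x' y', [/\ G x' y', `|x - x'| < e & `|y - y'| < e].

Lemma sub_closure_graph G x y : G x y -> closure_graph G x y.
Proof. by move=> Gxy e e0; exists x, y; rewrite !subrr !normr0. Qed.

Section IsometricGraph.
Variable G : X -> Y -> Prop.
Hypothesis iG : isometric_graph G.

Lemma graphB x y x' y' : G x y -> G x' y' -> G (x - x') (y - y').
Proof.
case: iG => G0 GL _ Gxy Gxy'; have := GL (- 1) _ _ _ _ Gxy' Gxy.
by rewrite !scaleN1r ![- _ + _]addrC.
Qed.

Lemma graph_dist x y x' y' : G x y -> G x' y' -> `|x - x'| = `|y - y'|.
Proof. by move=> Gxy Gxy'; case: iG => _ _; apply; exact: graphB. Qed.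

Lemma graph_fun x y y' : G x y -> G x y' -> y = y'.
Proof.
move=> Gxy Gxy'; apply/eqP; rewrite -subr_eq0 -normr_eq0 -(graph_dist Gxy Gxy').
by rewrite subrr normr0.
Qed.

Lemma linear_dom : linear_set (dom G).
Proof.
case: iG => G0 GL _; split; first by exists 0.
by move=> a x x' [y Gxy] [y' Gxy']; exists (a *: y + y'); exact: GL.
Qed.

Lemma isometric_closure_graph : isometric_graph (closure_graph G).
Proof.
case: (iG) => G0 GL GN; split; first exact: sub_closure_graph.
  move=> a x y x' y' Gxy Gxy' e e0.
  have a0 : 0 < `|a| + 1 by rewrite ltr_wpDl.
  have e20 : 0 < e / 2 by rewrite divr_gt0.
  have [x1 [y1 [G1 xx1 yy1]]] := Gxy _ (divr_gt0 e20 a0).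
  have [x2 [y2 [G2 xx2 yy2]]] := Gxy' _ e20.
  exists (a *: x1 + x2), (a *: y1 + y2); split; first exact: GL.
    rewrite opprD addrACA -scalerBr; apply: le_lt_trans (ler_normD _ _) _; rewrite normrZ.
    move: xx1; rewrite ltr_pdivlMr// => xx1.
    by have := normr_ge0 (x - x1); move: xx1 xx2; lra.
  rewrite opprD addrACA -scalerBr; apply: le_lt_trans (ler_normD _ _) _; rewrite normrZ.
  move: yy1; rewrite ltr_pdivlMr// => yy1.
  by have := normr_ge0 (y - y1); move: yy1 yy2; lra.
move=> x y Gxy; apply/eqP; rewrite eq_le; apply/andP; split; apply/ler_addgt0Pr => e e0;
  have [x1 [y1 [/GN xy1 xx1 yy1]]] := Gxy _ (divr_gt0 e0 (ltac:(lra) : 0 < 2 :> R)).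
  have := ler_normD (x - x1) x1; have := ler_normD (y1 - y) y.
  by rewrite !subrK (distrC y1); lra.
have := ler_normD (y - y1) y1; have := ler_normD (x1 - x) x.
by rewrite !subrK (distrC x1); lra.
Qed.

(** An isometric graph carries a sequence converging to x to a Cauchy sequence, and completeness of
    [Y] supplies the value at x. *)
Lemma dom_closure_graph : dom (closure_graph G) = closure (dom G).
Proof.
apply/seteqP; split=> [x [y Gxy]|x /closure_normP clx].
  apply/closure_normP => e /Gxy[x' [y' [Gxy' xx' _]]]; exists x' => //; by exists y'.
have h0 k : 0 < 2^-1 ^+ k :> R by rewrite exprn_gt0// invr_gt0.
have /choice[p pP] n : exists p : X * Y, G p.1 p.2 /\ `|x - p.1| < 2^-1 ^+ n.
  by have [x' [y' Gxy'] xx'] := clx _ (h0 n); exists (x', y').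
have hle k m : (k <= m)%N -> 2^-1 ^+ m <= 2^-1 ^+ k :> R.
  by move=> km; rewrite ler_wiXn2l ?invr_ge0 ?invf_le1 ?ler1n.
have [|y yP] := @cauchy_limit _ _ (fun n => (p n).2).
  move=> e e0; have [n0 hn0] := half_expn_lt (divr_gt0 e0 (ltac:(lra) : 0 < 2 :> R)).
  exists n0 => n m /hle hn /hle hm; have [Gn xn] := pP n; have [Gm xm] := pP m.
  rewrite -(graph_dist Gn Gm); have := ler_normD ((p n).1 - x) (x - (p m).1).
  by rewrite addrA subrK (distrC _ x); lra.
exists y => e e0; have [n0 n0P] := yP _ e0; have [n1 n1P] := half_expn_lt e0.
have [Gn xn] := pP (maxn n0 n1); exists (p (maxn n0 n1)).1, (p (maxn n0 n1)).2; split=> //.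
  by have := hle _ _ (leq_maxr n0 n1); lra.
by apply: n0P; exact: leq_maxl.
Qed.

End IsometricGraph.

Lemma linear_of_graph G : isometric_graph G -> dom G = [set: X] ->
  exists2 f : {linear X -> Y}, isometric_embedding f & forall x, G x (f x).
Proof.
move=> iG Gt; have /choice[f fP] x : exists y, G x y by have : dom G x by rewrite Gt.
have fL : linear f.
  move=> a x x'; case: (iG) => _ GL _; apply: (graph_fun iG) (fP _) _; exact: GL.
exists (HB.pack_for {linear X -> Y} f (GRing.isLinear.Build R X Y *:%R f fL)) => //=.
by move=> x; case: iG => _ _ /(_ _ _ (fP x)) /= ->.
Qed.

End Graph.

Lemma isometric_graph_sym (R : realType) (X Y : completeNormedModType R) (G : X -> Y -> Prop) :
  isometric_graph G -> isometric_graph (fun y x => G x y).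
Proof.
by move=> [G0 GL GN]; split=> // [a y x y' x'|y x /GN ->//]; exact: GL.
Qed.

(** The extension property quantifies over Banach spaces as types, so closed subspaces have to be
    realised as types. The norm has trivial kernel on [F], so the quotient map is injective there,
    and [i] is its inverse. *)
Lemma subspace_type (R : realType) (E : completeNormedModType R) (F : set E) :
  subspace_of F -> exists (X : completeNormedModType R) (i : {linear X -> E}),
  isometric_embedding i /\ range i = F.
Proof.
move=> /[dup] sF /subspace_ofP[cF lF].
have [| |u Fu cu|X [j [jL jN js]]] := @seminormed_quotient R E F Num.norm lF.1 lF.2.
- by move=> x y _ _; exact: ler_normD.
- by move=> a x _; rewrite normrZ.
- have [|l lu] := @cauchy_limit _ _ u.
    move=> e e0; have [n0 hn0] := half_expn_lt (divr_gt0 e0 (ltac:(lra) : 0 < 2 :> R)).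
    have hle k m : (k <= m)%N -> 2^-1 ^+ m <= 2^-1 ^+ k :> R.
      by move=> km; rewrite ler_wiXn2l ?invr_ge0 ?invf_le1 ?ler1n.
    exists n0 => n m hn hm; have := cu _ _ hn; have := cu _ _ hm.
    by have := ler_normD (u n - u n0) (u n0 - u m); rewrite addrA subrK (distrC _ (u n0)); lra.
  exists l.
    by apply: (subspace_closureP sF) => e /lu[n0 /(_ n0 (leqnn _))]; exists (u n0).
  by move=> e /lu[n0 n0P]; exists n0 => n; rewrite distrC; exact: n0P.
pose H (x : X) (e : E) := F e /\ j e = x.
have iH : isometric_graph H.
  split; first by split; [exact: lF.1|apply/normr0_eq0; rewrite jN ?normr0//; exact: lF.1].
    by move=> a x y x' y' [Fy <-] [Fy' <-]; split; [exact: lF.2|exact: jL].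
  by move=> x y [Fy <-]; exact: jN.
have [|i ii iP] := linear_of_graph iH.
  by apply/seteqP; split=> // x _; have [e Fe <-] := js x; exists e.
exists X, i; split=> //; apply/seteqP; split=> [_ [x _ <-]|e Fe]; first exact: (iP x).1.
exists (j e) => //; apply: (graph_fun iH) (iP _) _; by split.
Qed.

(** * Push-outs *)

Lemma subspace_set0 (R : realType) (E : completeNormedModType R) : subspace_of [set (0 : E)].
Proof.
apply/subspace_ofP; split; last by split=> // a x y -> ->; rewrite scaler0 addr0.
move=> x /closure_normP clx; apply/eqP; rewrite -normr_eq0 eq_le normr_ge0 andbT.
by apply/ler_addgt0Pr => e /clx[_ ->]; rewrite subr0 add0r => /ltW.
Qed.

Section Pushout.
Variables (R : realType) (E : completeNormedModType R).
Implicit Types (A B F S X Y Z C : set E) (x y z : E).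

(* The infimum formula of a push-out, with the admissible corrections r restricted to C. *)
Definition amalgamated C X S := forall x s, X x -> S s -> forall e, 0 < e ->
  exists2 r, C r & `|x + r| + `|s - r| < `|x + s| + e.

Lemma amalgamated_sub C C' X S X' S' : C `<=` C' -> X' `<=` X -> S' `<=` S ->
  amalgamated C X S -> amalgamated C' X' S'.
Proof.
move=> CC XX SS H x s /XX Xx /SS Ss e e0.
by have [r Cr h] := H x s Xx Ss e e0; exists r => //; exact: CC.
Qed.

Lemma amalgamated_closure C X S : amalgamated C X S -> amalgamated C (closure X) (closure S).
Proof.
move=> H x s /closure_normP clx /closure_normP cls e e0.
(* Five errors: each of the two approximations is paid twice, the amalgamation once. *)
have e50 : 0 < e / 5 by rewrite divr_gt0.
have [x' Xx' xx'] := clx _ e50; have [s' Ss' ss'] := cls _ e50.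
have [r Cr h] := H _ _ Xx' Ss' _ e50; exists r => //.
have := ler_normD (x - x') (x' + r); rewrite addrA subrK.
have := ler_normD (s - s') (s' - r); rewrite addrA subrK.
have := ler_normD (x' - x + (s' - s)) (x + s).
rewrite addrACA !subrK; have := ler_normD (x' - x) (s' - s).
by rewrite (distrC x') (distrC s'); lra.
Qed.

(** The triangle inequality always bounds the infimum from below by the norm of x + s, so the norm
    formula amounts to the existence of nearly optimal corrections. *)
Lemma pushoutP Y S X : subspace_of Y -> subspace_of S -> subspace_of X ->
  S `<=` Y -> X `<=` Y ->
  pushout Y S X <-> Y `<=` closure (sumset S X) /\ amalgamated (S `&` X) X S.
Proof.
move=> sY sS sX SY XY.
have lbd x s : has_lbound [set `|x + r| + `|s - r| | r in S `&` X].
  by exists 0 => _ [r _ <-]; rewrite addr_ge0.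
have ne x s : [set `|x + r| + `|s - r| | r in S `&` X] !=set0.
  exists (`|x + 0| + `|s - 0|); exists 0 => //.
  by split; [exact: (subspace_linear sS).1|exact: (subspace_linear sX).1].
split=> [[_ _ -> H]|[YS H]]; split=> //.
- move=> x s Xx Ss e e0.
  have [|_ [r Cr <-] h] := @inf_adherent _ [set `|x + r| + `|s - r| | r in S `&` X] _ e0.
    by split.
  by exists r => //; rewrite (H x s).
- apply/seteqP; split=> //; apply: sub_closure_subspace => // _ [s Ss [x Xx <-]].
  by apply: (linear_setD (subspace_linear sY)); [exact: SY|exact: XY].
move=> x s Xx Ss; apply/eqP; rewrite eq_le; apply/andP; split.
  apply: lb_le_inf; first exact: ne.
  move=> _ [r _ <-]; have := ler_normD (x + r) (s - r).
  by rewrite addrACA subrr addr0.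
apply/ler_addgt0Pr => e e0; have [r Cr /ltW h] := H x s Xx Ss e e0.
apply: le_trans h; apply: ge_inf; first exact: lbd.
by exists r.
Qed.

Lemma pushout_amalgamated Y S X : pushout Y S X -> amalgamated (S `&` X) X S.
Proof. by move=> /[dup] -[[? ? ?] [? ?] _ _] /pushoutP[]. Qed.

(** Push-outs can be tested on dense linear subsets, with corrections taken from the closures; the
    stages of the tower are handled in this way. *)
Lemma pushout_closure X S : linear_set X -> linear_set S ->
  amalgamated (closure S `&` closure X) X S ->
  pushout (closure (sumset S X)) (closure S) (closure X).
Proof.
move=> lX lS H; have sX := closure_subspace lX; have sS := closure_subspace lS.
have SS : S `<=` sumset S X.
  by move=> s Ss; exists s => //; exists 0; rewrite ?addr0//; exact: lX.1.
have XS : X `<=` sumset S X.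
  by move=> x Xx; exists 0; [exact: lS.1|exists x; rewrite ?add0r].
apply/pushoutP => //.
- exact/closure_subspace/linear_sumset.
- exact: closureS.
- exact: closureS.
split; last exact: amalgamated_closure.
apply: closureS => _ [s Ss [x Xx <-]].
by exists s; [exact: subset_closure|exists x => //; exact: subset_closure].
Qed.

(* For z = x + s the correction r witnessing the amalgamation of x with s + t gives
   the correction r - s for z and t. *)
Lemma pushout_intermediate Y T X Z : pushout Y T X -> subspace_of Z ->
  X `<=` Z -> Z `<=` Y -> Z `<=` closure (sumset (T `&` Z) X) -> pushout Y T Z.
Proof.
move=> /[dup] poY [[sY sT sX] [TY XY] YE _] sZ XZ ZY ZE.
have lT := subspace_linear sT; have lZ := subspace_linear sZ.
apply/pushoutP => //; split.
  rewrite YE; apply: closureS => _ [t Tt [x Xx <-]]; exists t => //.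
  by exists x => //; exact: XZ.
move=> z t /[dup] Zz /ZE/closure_normP clz Tt e e0.
have e50 : 0 < e / 5 by rewrite divr_gt0.
have [_ [s [Ts Zs] [x Xx <-]] zsx] := clz _ e50.
have [r [Tr Xr] h] := pushout_amalgamated poY Xx (linear_setD lT Ts Tt) e50.
exists (r - s).
  by split; [exact: linear_setB|apply: linear_setB => //; exact: XZ].
have -> : t - (r - s) = s + t - r by rewrite opprB addrA [t + s]addrC.
have -> : z + (r - s) = z - (s + x) + (x + r).
  by rewrite opprD (addrA z (- s)) [in RHS]addrA subrK addrA addrAC.
have := ler_normD (z - (s + x)) (x + r).
have := ler_normD (s + x - z) (z + t); rewrite addrA subrK (distrC _ z).
have -> : s + x + t = x + (s + t) by rewrite addrA [s + x]addrC.
by lra.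
Qed.

Lemma pushout_refl X : subspace_of X -> pushout X [set 0] X.
Proof.
move=> sX; have lX := subspace_linear sX.
have s0 := subspace_set0 E.
apply/pushoutP => //; first by move=> _ ->; exact: lX.1.
split; first by move=> x Xx; apply: subset_closure; exists 0 => //; exists x; rewrite ?add0r.
move=> x _ Xx -> e e0; exists 0; first by split=> //; exact: lX.1.
by rewrite subr0 normr0 !addr0 ltrDl.
Qed.

End Pushout.

(** * Well-orders and cardinals below the continuum *)

Section WellOrder.
Variables (L : Type) (le : rel L).
Hypothesis wo : wochoice.well_order le.
Local Notation lt a b := (~~ le b a).

Lemma wo_minimum (A : set L) : A !=set0 -> exists2 z, A z & forall y, A y -> le z y.
Proof.
move=> [x Ax]; have [|z [[Az zmin] _]] := wo (A := fun x => `[< A x >]).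
  by exists x; apply/asboolP.
by exists z => [|y Ay]; [apply/asboolP|apply: zmin; apply/asboolP].
Qed.

(** [wochoice.well_order] only asserts that nonempty sets have a unique minimum. The order axioms
    are recovered by applying it to sets of one, two and three elements. *)
Lemma wo_refl : reflexive le.
Proof. by move=> a; have [|z -> /(_ a erefl)] := wo_minimum (A := [set a]); first by exists a. Qed.

Lemma wo_total : total le.
Proof.
move=> a b; have [|z + zmin] := wo_minimum (A := [set a; b]); first by exists a; left.
by move=> [] ze; rewrite -?ze zmin ?orbT//; [right|left].
Qed.

Lemma wo_antisymmetric a b : le a b -> le b a -> a = b.
Proof.
move=> ab ba; have [|z [_ zu]] := wo (A := fun x => `[< x = a \/ x = b >]).
  by exists a; apply/asboolP; left.
rewrite -(zu a) ?(zu b)//; split; do ?[by apply/asboolP; (left + right)].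
- by move=> y /asboolP[] ->; [|exact: wo_refl].
- by move=> y /asboolP[] ->; [exact: wo_refl|].
Qed.

Lemma wo_trans : transitive le.
Proof.
move=> b a c ab bc.
have [|z + zmin] := wo_minimum (A := [set a; b; c]); first by exists a; left; left.
have [za zb zc] : [/\ le z a, le z b & le z c].
  by split; apply: zmin; [left; left|left; right|right].
move=> [[]|] ze; rewrite ze in za zb zc => //.
  by rewrite (wo_antisymmetric ab za).
by rewrite (wo_antisymmetric zb bc).
Qed.

Lemma wo_ltW a b : lt a b -> le a b.
Proof. by move=> ab; have := wo_total a b; rewrite (negbTE ab) orbF. Qed.

Lemma wo_lt_le_trans a b c : lt a b -> le b c -> lt a c.
Proof. by move=> + bc; apply: contra; exact: wo_trans. Qed.

Lemma wo_le_lt_trans a b c : le a b -> lt b c -> lt a c.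
Proof. by move=> ab; apply: contra => ca; exact: wo_trans ab. Qed.

Lemma wo_le_lt a b : le a b -> a <> b -> lt a b.
Proof. by move=> ab ne; apply/negP => /(wo_antisymmetric ab). Qed.

Lemma wo_ind (K : L -> Prop) :
  (forall b, (forall a, lt a b -> K a) -> K b) -> forall b, K b.
Proof.
move=> H b; apply: contrapT => nKb.
have [|z nKz zmin] := wo_minimum (A := [set x | ~ K x]); first by exists b.
apply: nKz; apply: H => a az; apply: contrapT => /zmin; exact/negP.
Qed.

(** Passing to [step] a total function, cut off to [u0] outside the initial segment, keeps its type
    non-dependent while still restricting it to earlier values. *)
Lemma wo_rec (U : Type) (u0 : U) (step : L -> (L -> U) -> U) :
  exists F : L -> U, forall b, F b = step b (fun a => if lt a b then F a else u0).
Proof.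
have wf : well_founded (fun a b => lt a b).
  by apply: wo_ind => b IH; constructor => a; exact: IH.
pose body b (rec : forall a, lt a b -> U) :=
  step b (fun a => if @idP (lt a b) is ReflectT ab then rec a ab else u0).
exists (Fix wf (fun=> U) body) => b; rewrite Fix_eq /body.
  by congr step; apply/funext => a; case: {2}(lt a b) / idP => [ab|nab]; rewrite ?ab//; case: ifP.
move=> x f g fg; congr step; apply/funext => a; case: {-}_ / idP => // ?; exact: fg.
Qed.

Lemma wo_succ a b : lt a b -> exists2 c, is_succ le a c & le c b.
Proof.
move=> ab; have [|c ac cmin] := wo_minimum (A := [set x | lt a x]); first by exists b.
by exists c; [split|exact: cmin].
Qed.
End WellOrder.

Lemma card_le_of_inj (T U : Type) (A : set T) (B : set U) (f : T -> U) :
  (forall x, A x -> B (f x)) -> (forall x y, A x -> A y -> f x = f y -> x = y) -> A #<= B.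
Proof.
move=> fAB finj; apply: card_le_trans (_ : f @` A #<= B).
  have : f @` A #= A by apply: inj_card_eq => x y; rewrite !inE; exact: finj.
  by rewrite card_eq_le => /andP[].
by apply: subset_card_le => _ [x /fAB ? <-].
Qed.

Lemma card_le_inj (T : Type) (U : pointedType) (A : set T) (B : set U) : A #<= B ->
  exists f : T -> U, (forall x, A x -> B (f x)) /\
                     (forall x y, A x -> A y -> f x = f y -> x = y).
Proof.
move=> /pcard_leP[f]; exists f; split=> [x Ax|x y Ax Ay]; first exact: funS.
by apply: inj; rewrite inE.
Qed.

(** * Sets that embed in the continuum, and small sets *)

Local Notation cc := [set: continuum].

Lemma continuum_embedding (T U : Type) (f : T -> U) :
  injective f -> [set: U] #<= cc -> [set: T] #<= cc.
Proof. by move=> finj; apply: card_le_trans; apply: (@card_le_of_inj _ _ _ _ f) => // x y _ _ /finj. Qed.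

Lemma continuum_seqs (T : Type) : [set: T] #<= cc -> [set: nat -> T] #<= cc.
Proof.
move=> /card_le_inj[f [_ finj]].
pose g (u : nat -> T) : continuum := fun n => if unpickle n is Some (i, j) then f (u i) j else false.
apply: (@card_le_of_inj _ _ _ _ g) => // u v _ _ uv; apply/funext => i.
apply: finj => //; apply/funext => j.
by have := congr1 (fun h => h (pickle (i, j))) uv; rewrite /g pickleK.
Qed.

Lemma continuum_prod (T U : Type) : [set: T] #<= cc -> [set: U] #<= cc -> [set: T * U] #<= cc.
Proof.
move=> /card_le_inj[f [_ finj]] /card_le_inj[g [_ ginj]].
have := continuum_seqs (card_lexx cc).
apply: (@continuum_embedding _ _ (fun (x : T * U) n => if n is 0%N then f x.1 else g x.2)).
move=> [x y] [x' y'] /= xy; congr (_, _).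
  by apply: finj => //; exact: (congr1 (fun h => h 0%N) xy).
by apply: ginj => //; exact: (congr1 (fun h => h 1%N) xy).
Qed.

Lemma continuum_option (T : Type) : [set: T] #<= cc -> [set: option T] #<= cc.
Proof.
move=> /card_le_inj[f [_ finj]].
pose g (x : option T) : continuum :=
  if x is Some y then fun n => if n is m.+1 then f y m else true else fun=> false.
apply: (@card_le_of_inj _ _ _ _ g) => // -[x|] [y|] //= _ _ xy.
- congr Some; apply: finj => //; apply/funext => n.
  exact: (congr1 (fun h => h n.+1) xy).
- by have := congr1 (fun h => h 0%N) xy.
- by have := congr1 (fun h => h 0%N) xy.
Qed.

Lemma continuum_seq (T : Type) : [set: T] #<= cc -> [set: seq T] #<= cc.
Proof.
move=> /continuum_option/continuum_seqs.
pose g (s : seq T) n := nth None (map some s) n.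
apply: (@card_le_trans _ _ _ [set: nat -> option T]).
apply: (@card_le_of_inj _ _ _ _ g) => // s t _ _; elim: s t => [|x s IH] [|y t] // st.
- by have := congr1 (fun h => h 0%N) st.
- by have := congr1 (fun h => h 0%N) st.
have [<-] := congr1 (fun h => h 0%N) st.
by rewrite (IH t)//; apply/funext => n; exact: (congr1 (fun h => h n.+1) st).
Qed.

(** A real is coded by its Dedekind cut in the rationals. *)
Lemma continuum_real (R : realType) : [set: R] #<= cc.
Proof.
pose g (x : R) : continuum := fun n => if unpickle n is Some q then ratr q < x else false.
apply: (@card_le_of_inj _ _ _ _ g) => // x y _ _.
wlog xy : x y / x < y.
  by move=> H gxy; have [/H ->|/H ->|] := ltgtP x y.
have [q] := @rat_in_itvoo R x y xy; rewrite in_itv /= => /andP[xq qy] gxy.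
have := congr1 (fun h => h (pickle q)) gxy; rewrite /g pickleK qy => /lt_trans/(_ xq).
by rewrite ltxx.
Qed.

Lemma continuum_nat : [set: nat] #<= cc.
Proof.
apply: (@card_le_of_inj _ _ _ _ (fun n => (fun m => m == n) : continuum)) => // x y _ _ xy.
by have := congr1 (fun h => h x) xy; rewrite /= eqxx => /esym/eqP.
Qed.

Lemma continuum_uncountable : ~ (cc #<= [set: nat]).
Proof.
move=> /card_le_inj[f [_ finj]].
(* Cantor's diagonal, written for an injection into nat: the value of [d] at [f d] can be neither
   true nor false. *)
pose d : continuum := fun n => `[< exists2 x : continuum, f x = n & x n = false >].
have [dt|df] := boolP (d (f d)).
  move/asboolP : (dt) => [x /finj xd]; rewrite xd//.
  by rewrite dt.
by move/asboolP: (df); apply; exists d => //; exact/negbTE.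
Qed.

Definition small (T : Type) (A : set T) := card_lt A cc.

Lemma small_le (T U : Type) (A : set T) (B : set U) : A #<= B -> small B -> small A.
Proof.
move=> AB [Bc nB]; split; first exact: card_le_trans AB Bc.
by move=> cA; apply: nB; exact: card_le_trans cA AB.
Qed.

Lemma small_countable (T : Type) (A : set T) : countable A -> small A.
Proof.
move=> cA; apply: small_le cA _; split; [exact: continuum_nat|exact: continuum_uncountable].
Qed.

Lemma small_image (T U : Type) (A : set T) (f : T -> U) : small A -> small (f @` A).
Proof. by apply: small_le; exact: card_image_le. Qed.

(** If some well-order has initial segments of full cardinality, take the least [a] with such a
    segment and pull the order back along an injection of [T] into that segment; minimality of [a]
    makes all segments of the new order smaller. *)
Lemma exists_initial_well_order (T : pointedType) : exists le : rel T, initial_well_order le.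
Proof.
have [r wr] := wochoice.well_ordering_principle T.
have [H|] := pselect (forall a, ~ ([set: T] #<= [set x | ~~ r a x])).
  by exists r; split=> // a; split=> //; exact: card_leT.
move=> /existsNP[a /contrapT aP].
have [|{aP}a aP amin] := wo_minimum wr (A := [set a | [set: T] #<= [set x | ~~ r a x]]).
  by exists a.
have [f [fa finj]] := card_le_inj aP.
exists (fun x y => r (f x) (f y)); split; last first.
  move=> b; split; first exact: card_leT.
  move=> /card_le_inj[g [gb ginj]].
  have /(_ I) := fa b; apply/negP; rewrite negbK; apply: amin.
  apply: (@card_le_of_inj _ _ _ _ (f \o g)) => [x /gb //|x y _ _ /= /finj fxy].
  by apply: ginj => //; exact: fxy.
move=> A [x Ax].
have [|z /asboolP[y Ay fy] zmin] := wo_minimum wr (A := [set z | `[< exists2 y, y \in A & f y = z >]]).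
  by exists (f x); apply/asboolP; exists x.
exists y; split; first split=> // t At.
  by rewrite fy; apply: zmin; apply/asboolP; exists t.
move=> t [At tmin]; apply: finj => //; apply: (wo_antisymmetric wr); last exact: tmin.
by rewrite fy; apply: zmin; apply/asboolP; exists t.
Qed.

Section Regular.
Variable le : rel continuum.
Hypotheses (hc : regular_cardinal continuum) (ile : initial_well_order le).

Lemma small_bounded (A : set continuum) : small A -> exists a, forall b, A b -> ~~ le a b.
Proof.
move=> [_ nA]; apply: contrapT => H; apply: nA.
suff : A #= cc by rewrite card_eq_le => /andP[].
apply: (hc.2 le ile) => a; apply: contrapT => aA; apply: H.
by exists a => b Ab; apply/negP => ab; apply: aA; exists b.
Qed.

(* A map from the continuum into the union has small, hence bounded, fibres over the index
   set; the bounds of the fibres are bounded by some a, which then lies in no fibre. *)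
Lemma small_bigcup (J : Type) (X : pointedType) (A : set J) (F : J -> set X) :
  small A -> (forall i, A i -> small (F i)) -> small (\bigcup_(i in A) F i).
Proof.
move=> sA sF.
have /choice[ix ixP] x : exists i : option J, (\bigcup_(i in A) F i) x ->
    exists2 j, i = Some j & A j /\ F j x.
  have [[i Ai Fix]|n] := pselect ((\bigcup_(i in A) F i) x); last by exists None.
  by exists (Some i) => _; exists i.
split.
  have /card_le_inj[f [_ finj]] := sA.1.
  have /choice[g gP] i : exists g : X -> continuum, A i ->
      forall x y, F i x -> F i y -> g x = g y -> x = y.
    have [/sF[/card_le_inj[g [_ ginj]] _]|nA] := pselect (A i); first by exists g.
    by exists (fun=> point).
  pose h x := if ix x is Some i then (f i, g i x) else point.
  apply: card_le_trans (continuum_prod (card_lexx cc) (card_lexx cc)).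
  apply: (@card_le_of_inj _ _ _ _ h) => // x y /ixP[i xi [Ai Fi]] /ixP[j yj [Aj Fj]].
  rewrite /h xi yj => -[/finj ij]; rewrite -ij// => gxy; apply: (gP i) gxy => //.
  by rewrite ij.
move=> /card_le_inj[f [fF finj]].
have fib i : A i -> exists b, forall t, ix (f t) = Some i -> ~~ le b t.
  move=> Ai; apply: (@small_bounded [set t | ix (f t) = Some i]).
  apply: small_le (sF i Ai); apply: (@card_le_of_inj _ _ _ _ f) => [t /= ti|x y _ _]; last exact: finj.
  by have [j tj [_ Fj]] := ixP _ (fF t I); move: tj; rewrite ti => -[->].
have /choice[b bP] i : exists b, A i -> forall t, ix (f t) = Some i -> ~~ le b t.
  by have [/fib[b ?]|nA] := pselect (A i); [exists b|exists point].
have [a aP] := small_bounded (small_image b sA).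
have [j aj [Aj Fj]] := ixP _ (fF a I).
have := aP _ (ex_intro2 _ _ j Aj erefl); have := bP _ Aj _ aj.
by have /orP[->|->] := wo_total ile.1 a (b j).
Qed.

Lemma small_segment (a : continuum) : small [set x | ~~ le a x].
Proof. exact: ile.2. Qed.

(** Initial segments are small, so a set of full cardinality cannot stay inside one. This yields
    late occurrences of each datum. *)
Lemma small_unboundedP (A : set continuum) (a : continuum) : cc #<= A -> exists2 b, A b & le a b.
Proof.
move=> cA; apply: contrapT => H; apply: (ile.2 a).2.
apply: card_le_trans cA _; apply: subset_card_le => b Ab.
by apply/negP => ab; apply: H; exists b.
Qed.
End Regular.

(** * Saturated sets of indices *)

Section Span.
Variables (R : realType) (W : lmodType R) (L : Type) (S : L -> set W).
Implicit Types (G D : set L) (x y : W).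

(** Kept purely algebraic, so that it serves both the pieces of a Banach space and the finitely
    supported functions of the tower. Scalar multiples come from the linearity of each [S a]. *)
Inductive lspan G : W -> Prop :=
| lspan0 : lspan G 0
| lspanS x a s : lspan G x -> G a -> S a s -> lspan G (x + s).

Lemma lspanW G D x : G `<=` D -> lspan G x -> lspan D x.
Proof.
by move=> GD; elim=> [|y a s _ IH Ga Ss]; [exact: lspan0|apply: lspanS Ss => //; exact: GD].
Qed.

Lemma lspan_gen G a s : G a -> S a s -> lspan G s.
Proof. by move=> Ga Ss; rewrite -[s]add0r; apply: lspanS Ga Ss; exact: lspan0. Qed.

Lemma lspanD G x y : lspan G x -> lspan G y -> lspan G (x + y).
Proof.
move=> Gx; elim=> [|z a s _ IH Ga Ss]; first by rewrite addr0.
by rewrite addrA; exact: lspanS IH Ga Ss.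
Qed.

Lemma lspan_countable G x : lspan G x -> exists C, [/\ countable C, C `<=` G & lspan C x].
Proof.
elim=> [|y a s _ [C [cC CG Cy]] Ga Ss]; first by exists set0; split=> //; exact: lspan0.
exists (C `|` [set a]); split.
- rewrite -(bigcup2E C [set a]); apply: bigcup_countable => //.
  by move=> [|[|n]] _ //=; exact: countable1.
- by move=> b [/CG //|->].
- by apply: lspanS Ss; [apply: lspanW Cy => b; left|right].
Qed.

Hypothesis lS : forall a, linear_set (S a).

Lemma linear_lspan G : linear_set (lspan G).
Proof.
split; first exact: lspan0.
move=> a x y Gx Gy; apply: lspanD Gy; elim: Gx => [|z b s _ IH Gb Ss].
  by rewrite scaler0; exact: lspan0.
by rewrite scalerDr; apply: lspanS IH Gb _; exact: linear_setZ.
Qed.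

Lemma lspan_min G (F : set W) : linear_set F -> (forall a, G a -> S a `<=` F) -> lspan G `<=` F.
Proof.
move=> lF GF x; elim=> [|y a s _ IH Ga Ss]; first exact: lF.1.
by apply: linear_setD => //; exact: GF Ss.
Qed.

Variable le : rel L.
Hypothesis wo : wochoice.well_order le.

Definition below (a : L) : set L := [set b | ~~ le a b].

Lemma belowS a b : le a b -> below a `<=` below b.
Proof. by move=> ab c; rewrite /below /= => ac; apply: (wo_lt_le_trans wo ac ab). Qed.

Lemma lspan_max G x : lspan G x -> x = 0 \/ exists2 a, G a & lspan (G `&` [set b | le b a]) x.
Proof.
elim=> [|y a s Gy IH Ga Ss]; [by left|right].
have [y0|[b Gb Gby]] := IH.
  exists a => //; rewrite y0; apply: lspanS (lspan0 _) _ Ss.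
  by split => //=; exact: wo_refl.
have /orP[ab|ba] := wo_total wo a b.
  by exists b => //; apply: lspanS Gby _ Ss; split.
exists a => //; apply: lspanS Ss; last by split=> //=; exact: wo_refl.
by apply: lspanW Gby => c [Gc cb]; split=> //; exact: (wo_trans wo cb).
Qed.

(** Splits off the summand of last index. The clause [G a \/ s = 0] discards that summand when [a]
    is outside [G]. *)
Lemma lspan_top G a x : lspan (G `&` [set b | le b a]) x ->
  exists y s, [/\ lspan (G `&` below a) y, S a s, G a \/ s = 0 & x = y + s].
Proof.
elim=> [|_ b t _ [y [s [Gy Ss Gs ->]]] [Gb ba] St].
  by exists 0, 0; split; [exact: lspan0|exact: (lS _).1|right|rewrite addr0].
have [ab|/(wo_le_lt wo ba) lba] := pselect (b = a).
  rewrite ab in Gb St; exists y, (s + t); split=> //; [|by left|by rewrite addrA].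
  exact: linear_setD.
exists (y + t), s; split=> //; last by rewrite addrAC.
by apply: lspanS Gy _ St.
Qed.
End Span.

Section Filtration.
Variables (R : realType) (E : completeNormedModType R) (L : Type).
Implicit Types (S : L -> set E) (G D : set L).

Definition hull S G : set E := closure (lspan S G).

(** A tight filtration expressed through the attached separable pieces alone. The filtering spaces
    become the hulls of initial segments, which makes continuity at limits automatic. *)
Definition pushout_filtration (le : rel L) S := [/\ wochoice.well_order le,
  forall a, subspace_of (S a) /\ separable_set (S a),
  forall a, amalgamated (S a `&` hull S (below le a)) (hull S (below le a)) (S a)
  & hull S [set: L] = [set: E]].

Variables (le : rel L) (S : L -> set E).
Hypothesis fS : pushout_filtration le S.
Let wo : wochoice.well_order le. Proof. by case: fS. Qed.
Let sS a : subspace_of (S a). Proof. by case: fS => _ /(_ a)[]. Qed.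
Let lS a : linear_set (S a). Proof. exact: subspace_linear. Qed.

Lemma hull_subspace G : subspace_of (hull S G).
Proof. by apply: closure_subspace; exact: linear_lspan. Qed.
Let lH G : linear_set (hull S G). Proof. exact/subspace_linear/hull_subspace. Qed.

Lemma hullW G D : G `<=` D -> hull S G `<=` hull S D.
Proof. by move=> GD; apply: closureS => x; exact: lspanW. Qed.

Lemma sub_hull G a : G a -> S a `<=` hull S G.
Proof. by move=> Ga x Sx; apply: subset_closure; exact: lspan_gen Ga Sx. Qed.

Lemma hull_min G F : subspace_of F -> (forall a, G a -> S a `<=` F) -> hull S G `<=` F.
Proof.
move=> sF GF; apply: sub_closure_subspace => //.
exact: lspan_min (subspace_linear sF) GF.
Qed.

(** A point of the closure is the limit of a sequence of combinations, each involving finitely many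
    pieces. *)
Lemma hull_countable G x : hull S G x -> exists C, [/\ countable C, C `<=` G & hull S C x].
Proof.
move=> /closure_normP clx.
have /choice[C CP] n : exists C, [/\ countable C, C `<=` G &
    exists2 a, lspan S C a & `|x - a| < 2^-1 ^+ n].
  have [|a /lspan_countable[C [cC CG Ca]] xa] := clx (2^-1 ^+ n).
    by rewrite exprn_gt0// invr_gt0.
  by exists C; split=> //; exists a.
exists (\bigcup_n C n); split.
- by apply: bigcup_countable => // n _; have [] := CP n.
- by move=> a [n _]; have [_ + _] := CP n; apply.
- apply/closure_normP => e /half_expn_lt[n hn]; have [_ _ [a Ca xa]] := CP n.
  exists a; last exact: lt_trans hn.
  by apply: lspanW Ca => b Cb; exists n.
Qed.

Lemma hull_separable_cover G (A : set E) : separable_set A -> A `<=` hull S G ->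
  exists C, [/\ countable C, C `<=` G & A `<=` hull S C].
Proof.
move=> [D [cD DA AD]] AG.
have /choice[C CP] x : exists C, D x -> [/\ countable C, C `<=` G & hull S C x].
  by have [/DA/AG/hull_countable[C ?]|nD] := pselect (D x); [exists C|exists set0].
exists (\bigcup_(x in D) C x); split.
- by apply: bigcup_countable => // x /CP[].
- by move=> a [x /CP[_ + _]]; apply.
- apply: subset_trans AD _; apply: sub_closure_subspace (hull_subspace _) _ => x Dx.
  have [_ _] := CP x Dx; apply: hullW => a Ca; by exists x.
Qed.

Lemma separable_hull D : countable D -> separable_set (hull S D).
Proof.
move=> cD; case: fS => _ sepS _ _.
have /choice[C CP] a := (sepS a).2.
have cC : countable (\bigcup_(a in D) C a) by apply: bigcup_countable => // a _; have [] := CP a.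
apply: separable_subset (separable_cspan cC) _; apply: hull_min; first exact: cspan_subspace.
move=> a Da; have [_ _ SC] := CP a; apply: subset_trans SC _.
apply: sub_closure_subspace; first exact: cspan_subspace.
by move=> x Cx; apply: sub_cspan; exists a.
Qed.

(* The hull of a saturated set of indices is filtered by its own pieces S a. *)
Definition saturated G := forall a, G a ->
  S a `&` hull S (below le a) `<=` hull S (G `&` below le a).

Lemma saturated_bigcup (I : Type) (A : set I) (F : I -> set L) :
  (forall i, A i -> saturated (F i)) -> saturated (\bigcup_(i in A) F i).
Proof.
move=> sF a [i Ai Fia] x /(sF i Ai a Fia); apply: hullW => b [Fib ab].
by split=> //; exists i.
Qed.

Lemma saturatedU G D : saturated G -> saturated D -> saturated (G `|` D).
Proof.
by move=> sG sD; rewrite -bigcup2E; apply: saturated_bigcup => -[|[|n]] _ //= a [].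
Qed.

(** By separability, what [S a] shares with the hull of [below le a] lies in the hull of a countable
    set [c a] of earlier indices. Closing [C] off under [c] in ω steps gives [D]. *)
Lemma countable_saturated C : countable C -> exists D, [/\ countable D, C `<=` D & saturated D].
Proof.
move=> cC.
have /choice[c cP] a : exists c, [/\ countable c, c `<=` below le a &
    S a `&` hull S (below le a) `<=` hull S c].
  apply: hull_separable_cover (@subIsetr _ _ _).
  by case: fS => _ /(_ a)[_ /separable_subset + _ _]; apply; exact: subIsetl.
pose D := fix D n := if n is m.+1 then \bigcup_(a in D m) c a else C.
have cD n : countable (D n).
  by elim: n => //= n IH; apply: bigcup_countable => // a _; have [] := cP a.
exists (\bigcup_n D n); split.
- by apply: bigcup_countable => // n _.
- by move=> a Ca; exists 0%N.
move=> a [n _ Dna] x /= Sx; have [_ ca /(_ x Sx)] := cP a; apply: hullW => b cb.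
by split; [exists n.+1 => //=; exists a|exact: ca].
Qed.

(* If the common last index a lies in both sets, the summand t of y at a is absorbed in
   the correction: it belongs to the hull of the intersection. *)
Lemma saturated_amalgamated_step G D (J : set L) : saturated G -> saturated D ->
  (forall a, J a -> amalgamated (hull S (G `&` D `&` below le a))
     (hull S (G `&` below le a)) (hull S (D `&` below le a))) ->
  (forall a b, J b -> le a b -> J a) ->
  amalgamated (hull S (G `&` D `&` J)) (hull S (G `&` J)) (hull S (D `&` J)).
Proof.
move=> satG satD IH Jle; apply: amalgamated_closure => x y Gx Dy e e0.
have e20 : 0 < e / 2 by rewrite divr_gt0.
have [[x0 y0]|[a [Ja Gax Day]]] : (x = 0 /\ y = 0) \/ exists a, [/\ J a,
    lspan S (G `&` [set b | le b a]) x & lspan S (D `&` [set b | le b a]) y].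
  have up K z a : lspan S ((K `&` J) `&` [set b | le b a]) z ->
      forall b, le a b -> lspan S (K `&` [set b' | le b' b]) z.
    move=> Kz b ab; apply: lspanW Kz => c [[Kc _] ca]; split=> //=; exact: wo_trans ab.
  have [->|[a [Ga Ja] /up ax]] := lspan_max wo Gx; have [->|[b [Db Jb] /up by_]] := lspan_max wo Dy.
  - by left.
  - right; exists b; split=> //; first exact: lspan0.
    by apply: by_; exact: wo_refl.
  - right; exists a; split=> //; last exact: lspan0.
    by apply: ax; exact: wo_refl.
  - right; have /orP[ab|ba] := wo_total wo a b.
      by exists b; split=> //; [exact: ax|apply: by_; exact: wo_refl].
    by exists a; split=> //; [apply: ax; exact: wo_refl|exact: by_].
- exists 0; first exact: (lH _).1.
  by rewrite x0 y0 subr0 addr0 normr0 !add0r.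
have [x' [s [Gx' Ss Gs ->]]] := lspan_top lS wo Gax.
have [y' [t [Dy' St Dt ->]]] := lspan_top lS wo Day.
have JS K b : J b -> hull S (K `&` below le b) `<=` hull S (K `&` J).
  move=> Jb; apply: hullW => c [Kc cb]; split=> //; apply: Jle Jb _; exact: wo_ltW.
have cl K : lspan S (K `&` below le a) `<=` hull S (K `&` below le a) by exact: subset_closure.
have cb K : lspan S (K `&` below le a) `<=` hull S (below le a).
  by move=> z Kz; apply: hullW (cl _ _ Kz); exact: subIsetr.
have [_ _ po _] := fS.
(* The push-out at [a] is applied to all lower terms x' + y' against all terms s + t of level a. The
   correction r lies in exactly the intersection that saturation controls: if [a] is in [G] it joins
   x', otherwise, if [a] is in [D], it joins y', and the induction hypothesis applies below [a]. *)
have [r [Sr Hr] hr] := po a _ _ (linear_setD (lH _) (cb _ _ Gx') (cb _ _ Dy'))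
  (linear_setD (lS a) Ss St) _ e20.
have split2 : x' + s + (y' + t) = x' + y' + (s + t) by rewrite addrACA.
have [Ga|nGa] := pselect (G a).
  have [r' Hr' hr'] := IH a Ja _ _ (linear_setD (lH _) (cl _ _ Gx') (satG a Ga r (conj Sr Hr)))
    (cl _ _ Dy') _ e20.
  have Ht : hull S (G `&` D `&` J) t.
    by case: Dt => [Da|->]; [apply: sub_hull St|exact: (lH _).1].
  exists (r' + t); first by apply: (linear_setD (lH _)) => //; exact: JS Hr'.
  have -> : x' + s + (r' + t) = (x' + r + r') + (s + t - r).
    by rewrite addrACA [x' + r + r']addrAC [s + t - r]addrC [in RHS]addrA addrK.
  have -> : y' + t - (r' + t) = y' - r' by rewrite opprD addrACA subrr addr0.
  have := ler_normD (x' + r + r') (s + t - r).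
  by move: hr hr'; rewrite split2 [x' + r + y']addrAC; lra.
have s0 : s = 0 by case: Gs.
rewrite s0 addr0 in split2 hr *.
have [Da|nDa] := pselect (D a).
  have [r' Hr' hr'] := IH a Ja _ _ (cl _ _ Gx')
    (linear_setD (lH _) (cl _ _ Dy') (satD a Da r (conj Sr Hr))) _ e20.
  exists r'; first exact: JS Hr'.
  have -> : y' + t - r' = (y' + r - r') + (t - r).
    by rewrite addrAC [y' + r - r']addrAC [t - r]addrC [in RHS]addrA addrK.
  have := ler_normD (y' + r - r') (t - r).
  by move: hr hr'; rewrite split2 !add0r addrA; lra.
have t0 : t = 0 by case: Dt.
rewrite t0 addr0.
have [r' Hr' hr'] := IH a Ja _ _ (cl _ _ Gx') (cl _ _ Dy') _ e0.
by exists r' => //; exact: JS Hr'.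
Qed.

Lemma saturated_amalgamated G D : saturated G -> saturated D ->
  amalgamated (hull S (G `&` D)) (hull S G) (hull S D).
Proof.
(* The step is used twice: with [J] all indices for the conclusion, and with [J] an initial segment
   inside the induction. *)
move=> sG sD; rewrite -[G `&` D]setIT -[X in amalgamated _ (hull S X)]setIT -[X in amalgamated _ _ (hull S X)]setIT.
apply: saturated_amalgamated_step => // b _; elim/(wo_ind wo): b => b IH.
apply: saturated_amalgamated_step => // a c; rewrite /below /= => cb ac.
exact: (wo_le_lt_trans wo ac cb).
Qed.

Lemma saturated_pushout G D : saturated G -> saturated D ->
  pushout (hull S (G `|` D)) (hull S D) (hull S G).
Proof.
move=> sG sD; apply/pushoutP; try exact: hull_subspace.
- by apply: hullW => a; right.
- by apply: hullW => a; left.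
split.
  apply: hull_min; first by apply: closure_subspace; exact: linear_sumset.
  move=> a [Ga|Da] x Sx; apply: subset_closure.
    exists 0; first exact: (lH _).1.
    by exists x; rewrite ?add0r//; exact: sub_hull Sx.
  exists x; first exact: sub_hull Sx.
  by exists 0; rewrite ?addr0//; exact: (lH _).1.
apply: amalgamated_sub (saturated_amalgamated sG sD) => //.
by move=> x Hx; split; apply: hullW Hx => a [].
Qed.
End Filtration.

(** * Back and forth *)

(** [S a] is the separable piece that leads from [X a] to its successor, so by transfinite induction
    [X b] is the hull of the pieces with index strictly below [b]. *)
Lemma tightly_filtered_pushout_filtration (R : realType) (E : completeNormedModType R) :
  tightly_sigma_filtered E ->
  exists (L : Type) (le : rel L) (S : L -> set E), pushout_filtration le S.
Proof.
move=> [L [le [X [[wo [top topP]] [[sX Xle] X0 XT Xs Xl]]]]].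
have s0 := subspace_set0 E.
have /choice[S SP] a : exists S, [/\ subspace_of S, separable_set S,
    amalgamated (S `&` X a) (X a) S & forall b, is_succ le a b -> X b = closure (sumset S (X a))].
  have [[b ab]|nb] := pselect (exists b, is_succ le a b); last first.
    (* An index without successor attaches nothing. *)
    exists [set 0]; split=> //.
    - by exists [set 0]; split=> //; exact: subset_closure.
    - exact: pushout_amalgamated (pushout_refl (sX a)).
    - by move=> b ab; case: nb; exists b.
  have [S sepS po] := Xs a b ab; exists S; split=> //.
  - by case: po => -[].
  - exact: pushout_amalgamated po.
  move=> c ac; have -> : c = b by apply: (wo_antisymmetric wo); [apply: ac.2; exact: ab.1|apply: ab.2; exact: ac.1].
  by case: po.
have lS a : linear_set (S a) by apply: subspace_linear; case: (SP a).
have sH G : subspace_of (hull S G) by apply: closure_subspace; exact: linear_lspan.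
have hmin G F : subspace_of F -> (forall a, G a -> S a `<=` F) -> hull S G `<=` F.
  move=> sF GF; apply: sub_closure_subspace => //.
  exact: lspan_min (subspace_linear sF) GF.
have hsub G a : G a -> S a `<=` hull S G.
  by move=> Ga x Sx; apply: subset_closure; exact: lspan_gen Ga Sx.
have XE b : X b = hull S (below le b).
  elim/(wo_ind wo): b => b IH.
  have [lb|nlb] := pselect (is_least le b).
    rewrite X0//; apply/seteqP; split=> [_ ->|]; first exact: (subspace_linear (sH _)).1.
    by apply: hmin => // a; rewrite /below /= lb.
  have [[a ab]|nsb] := pselect (exists a, is_succ le a b).
    have [sSa _ _ /(_ b ab) Xb] := SP a; have lab := ab.1.
    apply/seteqP; split.
      rewrite Xb; apply: sub_closure_subspace (sH _) _ => _ [s Ss [x Xx <-]].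
      apply: (linear_setD (subspace_linear (sH _))); first exact: hsub Ss.
      move: Xx; rewrite (IH a lab); apply: closureS => y; apply: lspanW.
      by apply: belowS => //; exact: wo_ltW.
    apply: hmin => // c cb x Sx; rewrite Xb; apply: subset_closure.
    have [ca|nca] := pselect (c = a).
      exists x; first by rewrite -ca.
      by exists 0; rewrite ?addr0//; exact: (subspace_linear (sX a)).1.
    exists 0; first exact: (lS a).1.
    exists x; rewrite ?add0r// (IH a lab); apply: hsub Sx.
    have /orP[ca|ac] := wo_total wo c a; first exact: (wo_le_lt wo).
    have lac : ~~ le c a by apply: (wo_le_lt wo) => // e; apply: nca.
    by move: cb; rewrite /below /= (ab.2 c lac).
  have lim : is_limit le b by split=> // a ab; apply: nsb; exists a.
  apply/seteqP; split.
    rewrite (Xl b lim); apply: sub_closure_subspace (sH _) _ => x [a ab].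
    rewrite (IH a ab); apply: closureS => y; apply: lspanW.
    by apply: belowS => //; exact: wo_ltW.
  apply: hmin => // c cb x Sx; rewrite (Xl b lim); apply: subset_closure.
  have [d cd db] := wo_succ wo cb.
  have ldb : ~~ le b d.
    by apply: (wo_le_lt wo db) => de; apply: nsb; exists c; rewrite -de.
  exists d => //; rewrite (IH d ldb); apply: hsub Sx; exact: cd.1.
exists L, le, S; split=> //.
- by move=> a; have [] := SP a.
- by move=> a; rewrite -XE; have [] := SP a.
- apply/seteqP; split=> // x _; have : X top x by rewrite XT.
  by rewrite XE; apply: closureS => y; exact: lspanW.
Qed.

(** * Transport along isometric embeddings, small density and countable generation *)

Section Pullback.
Variables (R : realType) (Y E : completeNormedModType R) (k : {linear Y -> E}).
Hypothesis ik : isometric_embedding k.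

Lemma isometric_dist x y : `|k x - k y| = `|x - y|.
Proof. by rewrite -raddfB ik. Qed.

Lemma isometric_inj : injective k.
Proof.
move=> x y kxy; apply/eqP; rewrite -subr_eq0 -normr_eq0 -isometric_dist kxy.
by rewrite subrr normr0.
Qed.

Lemma subspace_preimage T : subspace_of T -> subspace_of (k @^-1` T).
Proof.
move=> sT; have lT := subspace_linear sT; apply/subspace_ofP; split; last first.
  split; first by rewrite /preimage /= raddf0; exact: lT.1.
  by move=> a x y Tx Ty; rewrite /preimage /= linearP; exact: lT.2.
move=> x /closure_normP clx; apply: (subspace_closureP sT) => e /clx[y Ty xy].
by exists (k y) => //; rewrite isometric_dist.
Qed.

Lemma pushout_preimage T Z : pushout (range k) T Z ->
  pushout [set: Y] (k @^-1` T) (k @^-1` Z).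
Proof.
move=> po; have [[_ sT sZ] [TY ZY] YE _] := po.
apply/pushoutP => //; do ?exact: subspace_preimage; first exact: subspaceT.
split=> [y _|x s Zx Ts e e0].
  have : range k (k y) by exists y.
  rewrite YE => /closure_normP cly; apply/closure_normP => e /cly[_ [s Ts [x Zx <-]]].
  have [s' _ es] := TY _ Ts; have [x' _ ex] := ZY _ Zx; rewrite -es -ex -raddfD isometric_dist => h.
  exists (s' + x') => //; exists s'; first by rewrite /preimage /= es.
  by exists x' => //; rewrite /preimage /= ex.
have [r [Tr Zr]] := pushout_amalgamated po Zx Ts e0.
have [r' _ er] := TY _ Tr; rewrite -er -!raddfD -raddfB !ik => h.
by exists r' => //; rewrite /preimage /= er.
Qed.

Lemma separable_preimage T : separable_set T -> T `<=` range k -> separable_set (k @^-1` T).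
Proof.
move=> [D [cD DT TD]] Tk.
exists (k @^-1` D); split.
- by apply: sub_countable cD; apply: (@card_le_of_inj _ _ _ _ k) => // x y _ _; exact: isometric_inj.
- by move=> x /DT.
move=> x /TD/closure_normP clx; apply/closure_normP => e /clx[d Dd].
by have [y _ ky] := Tk _ (DT _ Dd); rewrite -ky isometric_dist => xy; exists y => //; rewrite /preimage /= ky.
Qed.
End Pullback.

Lemma dense_normP (R : realType) (E : completeNormedModType R) (D : set E) :
  dense D <-> forall x e, 0 < e -> exists2 d, D d & `|x - d| < e.
Proof.
split=> [dD x e e0|H O [x Ox] oO].
  have [||d [xd Dd]] := dD (ball x e); last by exists d => //; rewrite -ball_normE in xd.
  - by exists x; exact: ballxx.
  - exact: ball_open.
have /nbhs_ballP[e e0 eO] : nbhs x O by exact: open_nbhs_nbhs.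
by have [d Dd xd] := H x e e0; exists d; split=> //; apply: eO; rewrite -ball_normE.
Qed.

Definition small_dense (R : realType) (E : completeNormedModType R) (Z : set E) :=
  exists D, [/\ small D, D `<=` Z & Z `<=` closure D].

Lemma small_dense_dens_lt (R : realType) (X E : completeNormedModType R) (i : {linear X -> E}) :
  isometric_embedding i -> small_dense (range i) -> dens_lt X [set: continuum].
Proof.
move=> ii [D [sD Di iD]]; exists (i @^-1` D); last first.
  apply: small_le sD; apply: (@card_le_of_inj _ _ _ _ i) => // x y _ _; exact: isometric_inj.
apply/dense_normP => x e e0; have /closure_normP/(_ e e0)[d Dd] := iD (i x) (ex_intro2 _ _ x I erefl).
by have [y _ iy] := Di _ Dd; rewrite -iy isometric_dist// => xy; exists y => //; rewrite /preimage /= iy.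
Qed.

Lemma small_dense_graph (R : realType) (X Y : completeNormedModType R) (G : X -> Y -> Prop) :
  isometric_graph G -> small_dense (dom G) -> small_dense (dom (fun y x => G x y)).
Proof.
move=> iG [D [sD DG GD]].
have /choice[g gP] x : exists y, D x -> G x y.
  by have [/DG[y ?]|nD] := pselect (D x); [exists y|exists 0].
exists (g @` D); split; first exact: small_image.
  by move=> _ [x Dx <-]; exists x; exact: gP.
move=> y [x Gxy]; have /closure_normP clx := GD x (ex_intro _ y Gxy).
apply/closure_normP => e /clx[d Dd xd]; exists (g d); first by exists d.
by rewrite -(graph_dist iG Gxy (gP _ Dd)).
Qed.

(** A convergent sequence of values has Cauchy, hence convergent, arguments; their limit stays in
    the closed domain. *)
Lemma closed_graph (R : realType) (X Y : completeNormedModType R) (G : X -> Y -> Prop) :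
  isometric_graph G -> subspace_of (dom G) -> subspace_of (dom (fun y x => G x y)).
Proof.
move=> iG sG; have iG' := isometric_graph_sym iG.
apply/subspace_ofP; split; last exact: linear_dom iG'.
move=> y; rewrite -(dom_closure_graph iG') => -[x Gyx].
have Gxy : closure_graph G x y.
  by move=> e /Gyx[y' [x' [? ? ?]]]; exists x', y'.
have [y' Gxy'] : dom G x.
  have : dom (closure_graph G) x by exists y.
  by rewrite dom_closure_graph//; apply: sub_closure_subspace.
exists x; rewrite (graph_fun (isometric_closure_graph iG) Gxy (sub_closure_graph Gxy')).
exact: Gxy'.
Qed.

Definition sub_graph (X Y : Type) (G H : X -> Y -> Prop) := forall x y, G x y -> H x y.

(** In the middle of a back-and-forth step a domain need not be the hull of a saturated set.
    Countable generation over a fixed hull is what survives, and it suffices for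
    [pushout_intermediate]. *)
Definition countably_spanned (R : realType) (E : completeNormedModType R) (A Z : set E) :=
  [/\ subspace_of Z, A `<=` Z
    & exists D, [/\ countable D, D `<=` Z & Z `<=` cspan (A `|` D)]].

Lemma countableU (T : Type) (A B : set T) : countable A -> countable B -> countable (A `|` B).
Proof.
move=> cA cB; rewrite -bigcup2E; apply: bigcup_countable => //.
by move=> [|[|n]] _ //=; exact: countable0.
Qed.

(** * One-sided extension of a partial isometry *)

Section HalfStep.
Variables (R : realType) (E E' : completeNormedModType R).
Variables (L : Type) (le : rel L) (S : L -> set E) (le0 : rel continuum).
Hypotheses (hc : regular_cardinal continuum) (ile : initial_well_order le0).
Hypotheses (fS : pushout_filtration le S) (extE' : extension_property E').
Implicit Types (G : E -> E' -> Prop) (C D : set L).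

(** The sums of two dense sets form a union of countably many translates of a small set, which
    regularity keeps small. *)
Lemma small_dense_hullU C D : small_dense (hull S C) -> countable D -> small_dense (hull S (C `|` D)).
Proof.
move=> [A [sA AC CA]] cD; have [B [cB BD DB]] := separable_hull fS cD.
have sH K := hull_subspace fS K.
exists (sumset A B); split.
- have -> : sumset A B = \bigcup_(b in B) ((fun a => a + b) @` A).
    apply/seteqP; split=> [_ [a Aa [b Bb <-]]|_ [b Bb [a Aa <-]]].
      by exists b => //; exists a.
    by exists a => //; exists b.
  apply: (small_bigcup hc ile); first exact: small_countable.
  by move=> b _; exact: small_image.
- move=> _ [a Aa [b Bb <-]]; apply: (linear_setD (subspace_linear (sH _))).
    by apply: hullW (AC _ Aa) => x; left.
  by apply: hullW (BD _ Bb) => x; right.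
have sub : sumset (hull S C) (hull S D) `<=` closure (sumset A B).
  move=> _ [x /CA/closure_normP clx [y /DB/closure_normP cly <-]].
  apply/closure_normP => e e0; have e20 : 0 < e / 2 by rewrite divr_gt0.
  have [a Aa xa] := clx _ e20; have [b Bb yb] := cly _ e20.
  exists (a + b); first by exists a => //; exists b.
  by rewrite opprD addrACA; have := ler_normD (x - a) (y - b); lra.
apply: subset_trans (_ : closure (sumset (hull S C) (hull S D)) `<=` _); last first.
  by rewrite [X in _ `<=` X](closure_id _).1; [exact: closureS|exact: closed_closure].
apply: (hull_min); first by apply/closure_subspace/linear_sumset; exact: subspace_linear.
move=> a [Ca|Da] x Sx; apply: subset_closure.
  exists x; first exact: sub_hull Sx.
  by exists 0; rewrite ?addr0//; exact: (subspace_linear (sH _)).1.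
exists 0; first exact: (subspace_linear (sH _)).1.
by exists x; rewrite ?add0r//; exact: sub_hull Sx.
Qed.

(** [D] is chosen to catch the countably many generators of [dom G] over [hull S C]. Then
    [hull S (C]|[D)] is a push-out over [dom G] as well, so the extension property of [E'] extends
    [G] to it. The range grows only by a separable set, which preserves countable generation over
    [A]. *)
Lemma extend_graph G C A C0 : isometric_graph G -> saturated le S C ->
  countably_spanned (hull S C) (dom G) ->
  countably_spanned A (dom (fun y x => G x y)) ->
  small_dense (hull S C) -> small_dense (dom G) -> countable C0 ->
  exists D G1, [/\ [/\ countable D, C0 `<=` D & saturated le S D],
    isometric_graph G1 /\ sub_graph G G1, dom G1 = hull S (C `|` D),
    countably_spanned (hull S C) (dom G1) /\ countably_spanned A (dom (fun y x => G1 x y))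
    & small_dense (dom G1)].
Proof.
move=> iG satC [sG CG [B [cB BG GB]]] [sG' AG' [B' [cB' BG' GB']]] sdC sdG cC0.
have sH K := hull_subspace fS K.
have [C1 [cC1 _ BC1]] : exists C1, [/\ countable C1, C1 `<=` [set: L] & B `<=` hull S C1].
  apply: (hull_separable_cover fS); first by exists B; split=> //; exact: subset_closure.
  by case: fS => _ _ _ ->.
have [D [cD CD satD]] := countable_saturated fS (countableU cC0 cC1).
have po := saturated_pushout fS satC satD.
have [[sY sT _] [TY XY] YE _] := po.
have BD : B `<=` hull S D.
  by apply: subset_trans BC1 _; apply: hullW => a aC; apply: CD; right.
have GY : dom G `<=` hull S (C `|` D).
  by apply: subset_trans GB _; apply: cspan_min => // x [/XY //|/BD/TY].
have lG := linear_dom iG.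
have poG : pushout (hull S (C `|` D)) (hull S D) (dom G).
  apply: pushout_intermediate po sG CG GY _.
  apply: subset_trans GB _; apply: cspan_min.
    apply: closure_subspace; apply: linear_sumset; last exact: subspace_linear.
    have lD := subspace_linear sT; split; first by split; [exact: lD.1|exact: lG.1].
    by move=> a x y [? ?] [? ?]; split; [exact: lD.2|exact: lG.2].
  move=> x xCB; apply: subset_closure; case: xCB => [Cx|Bx].
    exists 0; first by split; [exact: (subspace_linear sT).1|exact: lG.1].
    by exists x; rewrite ?add0r.
  exists x; first by split; [exact: BD|exact: BG].
  by exists 0; rewrite ?addr0//; exact: (subspace_linear (sH _)).1.
(* [X] and [Y] realise [dom G] and the larger hull as types; [v] becomes the inclusion and [u] the
   isometry described by [G]. *)
have [X [i [ii ri]]] := subspace_type sG.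
have [Y [k [ik rk]]] := subspace_type sY.
have [v iv vP] : exists2 v : {linear X -> Y}, isometric_embedding v & forall x, i x = k (v x).
  apply: (@linear_of_graph _ _ _ (fun x y => i x = k y)).
    split; first by rewrite !raddf0.
      by move=> a x y x' y' xy xy'; rewrite !linearP xy xy'.
    by move=> x y xy; rewrite -ii -ik xy.
  apply/seteqP; split=> // x _; have : range i (i x) by exists x.
  by rewrite ri => /GY; rewrite -rk => -[y _ ky]; exists y.
have [u iu uP] : exists2 u : {linear X -> E'}, isometric_embedding u & forall x, G (i x) (u x).
  case: (iG) => G0 GL GN; apply: (@linear_of_graph _ _ _ (fun x y => G (i x) y)).
    split; first by rewrite raddf0.
      by move=> a x y x' y' xy xy'; rewrite linearP; exact: GL.
    by move=> x y /GN; rewrite ii.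
  apply/seteqP; split=> // x _; have : range i (i x) by exists x.
  by rewrite ri.
have pv : posex_embedding v.
  split=> //; exists (k @^-1` hull S D).
    by apply: separable_preimage => //; [exact: (separable_hull fS)|rewrite rk].
  have -> : range v = k @^-1` dom G.
    rewrite -ri; apply/seteqP; split=> [_ [x _ <-]|y [x _ xy]]; first by exists x.
    by exists x => //; apply: (isometric_inj ik); rewrite -vP.
  by apply: pushout_preimage => //; rewrite rk.
have [w iw wP] := extE' iu pv (small_dense_dens_lt ii (ltac:(by rewrite ri) : small_dense (range i))).
pose G1 x y := exists z, k z = x /\ w z = y.
have iG1 : isometric_graph G1.
  split; first by exists 0; rewrite !raddf0.
    by move=> a x y x' y' [z [<- <-]] [z' [<- <-]]; exists (a *: z + z'); rewrite !linearP.
  by move=> x y [z [<- <-]]; rewrite ik iw.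
have GG1 : sub_graph G G1.
  move=> x y Gxy; have : dom G x by exists y.
  rewrite -ri => -[z _ zx]; exists (v z); rewrite -vP wP zx; split=> //.
  by apply: (graph_fun iG) Gxy; rewrite -zx.
have dG1 : dom G1 = hull S (C `|` D).
  rewrite -rk; apply/seteqP; split=> [x [y [z [<- _]]]|_ [z _ <-]]; first by exists z.
  by exists (w z), z.
have [B1 [cB1 B1D DB1]] := separable_hull fS cD.
have sdG1 : small_dense (dom G1) by rewrite dG1; exact: small_dense_hullU.
exists D, G1; split=> //.
- by split=> // a aC; apply: CD; left.
split.
  split; [by rewrite dG1|by rewrite dG1; exact: XY|exists B1; split=> //].
    by rewrite dG1; apply: subset_trans B1D TY.
  rewrite dG1 YE; apply: sub_closure_subspace; first exact: cspan_subspace.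
  have lsp := subspace_linear (cspan_subspace (hull S C `|` B1)).
  move=> _ [s Ds [x Cx <-]]; apply: (linear_setD lsp); last by apply: sub_cspan; left.
  apply: sub_closure_subspace (cspan_subspace _) _ _ (DB1 _ Ds) => b Bb.
  by apply: sub_cspan; right.
have /choice[g gP] x : exists y, B1 x -> G1 x y.
  have [/B1D/TY|nB] := pselect (B1 x); last by exists 0.
  by rewrite -dG1 => -[y Gy]; exists y.
split.
- by apply: closed_graph => //; rewrite dG1.
- by move=> y /AG'[x /GG1 Gxy]; exists x.
exists (B' `|` g @` B1); split.
- by apply: countableU => //; apply: sub_countable cB1; exact: card_image_le.
- by move=> y [/BG'[x /GG1 Gxy]|[x Bx <-]]; exists x => //; exact: gP.
move=> y [x Gxy]; apply: (subspace_closureP (cspan_subspace _)) => e e0.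
have : dom G1 x by exists y.
rewrite dG1; case: poG => _ _ -> _ => /closure_normP clx.
have e20 : 0 < e / 2 by rewrite divr_gt0.
(* By the push-out, x is close to t + z with t in [hull S D] and z in the old domain. Replacing t by
   a point b of the countable set [B1] puts the value [g b + yz] in the required span. *)
have [_ [t /DB1/closure_normP clt [z [yz Gz] <-]] xt] := clx _ e20.
have [b Bb tb] := clt _ e20; exists (g b + yz).
  have lsp := subspace_linear (cspan_subspace (A `|` (B' `|` g @` B1))).
  apply: (linear_setD lsp); first by apply: sub_cspan; right; right; exists b.
  have : dom (fun y x => G x y) yz by exists z.
  by move=> /GB'; apply: cspanS => q [?|?]; [left|right; left].
have Gbz : G1 (b + z) (g b + yz).
  case: iG1 => _ GL _; have := GL 1 _ _ _ _ (gP _ Bb) (GG1 _ _ Gz).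
  by rewrite !scale1r.
rewrite -(graph_dist iG1 Gxy Gbz).
have := ler_normD (x - (t + z)) (t - b).
have -> : x - (t + z) + (t - b) = x - (b + z).
  by rewrite !opprD [- t - z]addrC addrA addrA subrK [in RHS]addrA addrAC.
by lra.
Qed.
End HalfStep.

(** * Unions of chains of partial isometries *)

Local Notation flip G := (fun y x => G x y).

(** The pair (0, 0) is added so that the empty chain, which occurs at the first stage of the
    transfinite construction, also gives an isometric graph. *)
Definition union_graph (R : realType) (X Y : completeNormedModType R) (I : Type) (A : set I)
    (F : I -> X -> Y -> Prop) : X -> Y -> Prop :=
  fun x y => (x = 0 /\ y = 0) \/ exists2 i, A i & F i x y.

Section UnionGraph.
Variables (R : realType) (X Y : completeNormedModType R) (I : Type) (A : set I).
Variable F : I -> X -> Y -> Prop.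

Lemma flip_union_graph : flip (union_graph A F) = union_graph A (fun i => flip (F i)).
Proof.
apply/funext => y; apply/funext => x; apply/propext.
by split=> -[[-> ->]|[i Ai Fi]]; do [by left|by right; exists i].
Qed.

Lemma flip_closure_graph (G : X -> Y -> Prop) : flip (closure_graph G) = closure_graph (flip G).
Proof.
apply/funext => y; apply/funext => x; apply/propext.
by split=> H e /H[? [? [? ? ?]]]; do 2 eexists; split; eassumption.
Qed.

Hypothesis iF : forall i, A i -> isometric_graph (F i).
Hypothesis chF : forall i j, A i -> A j -> sub_graph (F i) (F j) \/ sub_graph (F j) (F i).

Lemma isometric_union_graph : isometric_graph (union_graph A F).
Proof.
split; first by left.
- move=> a x y x' y' [[-> ->]|[i Ai Fi]] [[-> ->]|[j Aj Fj]].
  + by left; rewrite !scaler0 !addr0.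
  + by right; exists j; rewrite // !scaler0 !add0r.
  + by right; exists i => //; case: (iF Ai) => F0 FL _; exact: FL.
  + have [ij|ji] := chF Ai Aj; right.
      by exists j => //; case: (iF Aj) => _ FL _; apply: FL => //; exact: ij.
    by exists i => //; case: (iF Ai) => _ FL _; apply: FL => //; exact: ji.
- by move=> x y [[-> ->]|[i Ai]]; [rewrite !normr0|case: (iF Ai) => _ _; exact].
Qed.

(** Interleaving: each domain lies in a hull that lies in some domain of the chain, so domains and
    hulls have the same closed union. *)
Lemma dom_closure_union_graph (L : Type) (le : rel L) (S : L -> set X) (K : I -> set L) :
  pushout_filtration le S ->
  (forall i, A i -> dom (F i) `<=` hull S (K i) /\ exists2 j, A j & hull S (K i) `<=` dom (F j)) ->
  dom (closure_graph (union_graph A F)) = hull S (\bigcup_(i in A) K i).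
Proof.
move=> fS KF; rewrite (dom_closure_graph isometric_union_graph); apply/seteqP; split.
  apply: sub_closure_subspace (hull_subspace fS _) _ => x [y [[-> _]|[i Ai Fi]]].
    exact: (subspace_linear (hull_subspace fS _)).1.
  have : dom (F i) x by exists y.
  by move=> /(KF i Ai).1; apply: hullW => a Ka; exists i.
apply: hull_min; first by apply: closure_subspace; exact: linear_dom isometric_union_graph.
move=> a [i Ai Kia] x Sx; apply: subset_closure.
have [_ [j Aj]] := KF i Ai; move=> /(_ x (sub_hull Kia Sx))[y Fy].
by exists y; right; exists j.
Qed.
End UnionGraph.

(** * The transfinite back-and-forth *)

Section BackAndForth.
Variables (R : realType) (E E' : completeNormedModType R).
Variables (L L' : Type) (le : rel L) (le' : rel L') (S : L -> set E) (S' : L' -> set E').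
Variable le0 : rel continuum.
Hypotheses (hc : regular_cardinal continuum) (ile : initial_well_order le0).
Hypotheses (fS : pushout_filtration le S) (fS' : pushout_filtration le' S').
Hypotheses (extE : extension_property E) (extE' : extension_property E').
Implicit Types (G : E -> E' -> Prop).

(** Saturation on both sides is what allows a back-and-forth step to be started afresh from [G]. *)
Definition nice_graph G := [/\ isometric_graph G,
  exists2 C, saturated le S C & dom G = hull S C,
  exists2 C', saturated le' S' C' & dom (flip G) = hull S' C'
  & small_dense (dom G)].

(** The ω intermediate graphs are all measured against the hulls of the initial [C] and [C'], not
    against one another. *)
Let invariant C C' G := [/\ isometric_graph G, countably_spanned (hull S C) (dom G),
  countably_spanned (hull S' C') (dom (flip G)) & small_dense (dom G)].

Let two_steps C C' G B B' : saturated le S C -> saturated le' S' C' ->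
  small_dense (hull S C) -> small_dense (hull S' C') -> countable B -> countable B' ->
  invariant C C' G -> exists G2 D D', [/\ invariant C C' G2, sub_graph G G2,
    [/\ saturated le S D, countable D, B `<=` D, dom G `<=` hull S (C `|` D)
      & hull S (C `|` D) `<=` dom G2]
  & [/\ saturated le' S' D', B' `<=` D', dom (flip G) `<=` hull S' (C' `|` D')
      & hull S' (C' `|` D') `<=` dom (flip G2)]].
Proof.
move=> satC satC' sC sC' cB cB' [iG spG spG' sG].
have [D [G1 [[cD BD satD] [iG1 GG1] dG1 [sp1 sp1'] sG1]]] :=
  extend_graph hc ile fS extE' iG satC spG spG' sC sG cB.
have [D' [G2 [[cD' BD' satD'] [iG2 GG2] dG2 [sp2 sp2'] sG2]]] :=
  extend_graph hc ile fS' extE (isometric_graph_sym iG1) satC' sp1' sp1 sC'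
    (small_dense_graph iG1 sG1) cB'.
exists (flip G2), D, D'; split.
- split=> //; first exact: isometric_graph_sym iG2.
  exact: (small_dense_graph iG2).
- by move=> x y /GG1/GG2.
- split=> //; first by rewrite -dG1 => x [y /GG1 Gxy]; exists y.
  by rewrite -dG1 => x [y Gxy]; exists y; exact: GG2.
- by split=> //; rewrite -dG2 => // y [x /GG1/GG2 Gxy]; exists x.
Qed.

Lemma nice_graph_extension G x y : nice_graph G ->
  exists G2, [/\ nice_graph G2, sub_graph G G2, dom G2 x & dom (flip G2) y].
Proof.
move=> [iG [C satC dG] [C' satC' dG'] sG].
have sC : small_dense (hull S C) by rewrite -dG.
have sC' : small_dense (hull S' C') by rewrite -dG'; exact: small_dense_graph.
have [B [cB _ Bx]] : exists B, [/\ countable B, B `<=` [set: L] & hull S B x].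
  by apply: (hull_countable (G := [set: L])); case: fS => _ _ _ ->.
have [B' [cB' _ By]] : exists B', [/\ countable B', B' `<=` [set: L'] & hull S' B' y].
  by apply: (hull_countable (G := [set: L'])); case: fS' => _ _ _ ->.
pose St := {G : E -> E' -> Prop | invariant C C' G}.
have inv0 : invariant C C' G.
  split=> //.
    rewrite dG; split=> //; first exact: (hull_subspace fS).
    by exists set0; split=> // z Cz; apply: sub_cspan; left.
  rewrite dG'; split=> //; first exact: (hull_subspace fS').
  by exists set0; split=> // z Cz; apply: sub_cspan; left.
have /choice[next nextP] (s : St) : exists p : St * (set L * set L'),
    [/\ sub_graph (sval s) (sval p.1),
      [/\ saturated le S p.2.1, countable p.2.1, B `<=` p.2.1,
        dom (sval s) `<=` hull S (C `|` p.2.1) & hull S (C `|` p.2.1) `<=` dom (sval p.1)]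
    & [/\ saturated le' S' p.2.2, B' `<=` p.2.2, dom (flip (sval s)) `<=` hull S' (C' `|` p.2.2)
        & hull S' (C' `|` p.2.2) `<=` dom (flip (sval p.1))]].
  have [G2 [D [D' [inv2 GG2 H H']]]] := two_steps satC satC' sC sC' cB cB' (svalP s).
  by exists (exist _ G2 inv2, (D, D')).
(* Each step attaches a new countable saturated set to the original [C] and [C']. Only the graphs
   have to increase; the sets [D n] are tied together by the interleaving of domains and hulls. *)
pose st n := iter n (fun s => (next s).1) (exist _ G inv0 : St).
pose F n := sval (st n).
pose D n := (next (st n)).2.1; pose D' n := (next (st n)).2.2.
have iF n : isometric_graph (F n) by case: (svalP (st n)).
have FS n : sub_graph (F n) (F n.+1) by case: (nextP (st n)).
have Fle m n : (m <= n)%N -> sub_graph (F m) (F n).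
  move=> /subnK <-; elim: (n - m)%N => //= k IH a b /IH; exact: FS.
have chF m n : sub_graph (F m) (F n) \/ sub_graph (F n) (F m).
  by have [/Fle|/ltnW/Fle] := leqP m n; [left|right].
have iU := @isometric_union_graph _ _ _ nat setT F (fun i _ => iF i) (fun i j _ _ => chF i j).
pose G2 := closure_graph (union_graph setT F).
have dG2 : dom G2 = hull S (\bigcup_n (C `|` D n)).
  apply: (dom_closure_union_graph _ _ fS) => // n _.
  by have [_ [_ _ _ h1 h2] _] := nextP (st n); split=> //; exists n.+1.
have dG2' : dom (flip G2) = hull S' (\bigcup_n (C' `|` D' n)).
  rewrite /G2 flip_closure_graph flip_union_graph.
  apply: (dom_closure_union_graph _ _ fS') => [i _|i j _ _|n _].
  - exact: isometric_graph_sym.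
  - by have [ij|ji] := chF i j; [left=> a b /ij|right=> a b /ji].
  - by have [_ _ [_ _ h1 h2]] := nextP (st n); split=> //; exists n.+1.
exists G2; split.
- split; first exact: isometric_closure_graph.
  + exists (\bigcup_n (C `|` D n)) => //; apply: saturated_bigcup => n _.
    by apply: saturatedU => //; have [_ []] := nextP (st n).
  + exists (\bigcup_n (C' `|` D' n)) => //; apply: saturated_bigcup => n _.
    by apply: saturatedU => //; have [_ _ []] := nextP (st n).
  (* Separating the fixed [C] from the countable union of the [D n] reduces small density to adding
     countably many pieces. *)
  + have -> : dom G2 = hull S (C `|` \bigcup_n D n).
      rewrite dG2; congr (hull S); apply/seteqP; split=> [a [n _ [?|?]]|a [?|[n _ ?]]].
      * by left.
      * by right; exists n.
      * by exists 0%N => //; left.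
      * by exists n => //; right.
    apply: (small_dense_hullU hc ile fS sC).
    by apply: bigcup_countable => // n _; have [_ []] := nextP (st n).
- by move=> a b Gab; apply: sub_closure_graph; right; exists 0%N.
- rewrite dG2; apply: hullW Bx => a Ba; exists 0%N => //; right.
  by have [_ [_ _ h _ _] _] := nextP (st 0%N); exact: h.
- rewrite dG2'; apply: hullW By => a Ba; exists 0%N => //; right.
  by have [_ _ [_ h _ _]] := nextP (st 0%N); exact: h.
Qed.

Lemma nice_union_graph (I : Type) (A : set I) (F : I -> E -> E' -> Prop) :
  (forall i, A i -> nice_graph (F i)) ->
  (forall i j, A i -> A j -> sub_graph (F i) (F j) \/ sub_graph (F j) (F i)) ->
  small A -> nice_graph (closure_graph (union_graph A F)).
Proof.
move=> nF chF sA.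
have iF i : A i -> isometric_graph (F i) by move=> /nF[].
have iU := isometric_union_graph iF chF.
split; first exact: isometric_closure_graph.
- have /choice[C CP] i : exists C, A i -> saturated le S C /\ dom (F i) = hull S C.
    by have [/nF[_ [C ? ?] _ _]|nA] := pselect (A i); [exists C|exists set0].
  exists (\bigcup_(i in A) C i); first by apply: saturated_bigcup => i /CP[].
  apply: (dom_closure_union_graph _ _ fS) => // i Ai.
  by have [_ dF] := CP i Ai; rewrite -dF; split=> //; exists i.
- have /choice[C CP] i : exists C, A i -> saturated le' S' C /\ dom (flip (F i)) = hull S' C.
    by have [/nF[_ _ [C ? ?] _]|nA] := pselect (A i); [exists C|exists set0].
  exists (\bigcup_(i in A) C i); first by apply: saturated_bigcup => i /CP[].
  rewrite flip_closure_graph flip_union_graph.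
  apply: (dom_closure_union_graph _ _ fS') => [i Ai|i j Ai Aj|i Ai].
  + exact/isometric_graph_sym/iF.
  + by have [ij|ji] := chF i j Ai Aj; [left=> a b /ij|right=> a b /ji].
  + by have [_ dF] := CP i Ai; rewrite -dF; split=> //; exists i.
have /choice[D DP] i : exists D, A i -> [/\ small D, D `<=` dom (F i) & dom (F i) `<=` closure D].
  by have [/nF[_ _ _ [D ?]]|nA] := pselect (A i); [exists D|exists set0].
rewrite (dom_closure_graph iU).
(* The point 0 accounts for the pair (0, 0) of [union_graph], the whole graph when [A] is empty. *)
exists ([set 0] `|` \bigcup_(i in A) D i); split.
- apply: small_le (_ : small (\bigcup_(b in [set: bool]) if b then [set 0] else \bigcup_(i in A) D i)).
    by apply: subset_card_le => x [?|?]; [exists true|exists false].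
  apply: (small_bigcup hc ile); first exact/small_countable/countableP.
  move=> [] _; first exact/small_countable/countable1.
  by apply: (small_bigcup hc ile) => // i /DP[].
- move=> x H; apply: subset_closure; case: H => [->|[i Ai]]; first exact: (linear_dom iU).1.
  by have [_ Di _] := DP i Ai; move=> /Di[y Fy]; exists y; right; exists i.
rewrite [X in _ `<=` X](closure_id _).1; last exact: closed_closure.
apply: closureS => x [y [[-> _]|[i Ai Fi]]]; first by apply: subset_closure; left.
have [_ _ h] := DP i Ai; have : dom (F i) x by exists y.
by move=> /h; apply: closureS => z Dz; right; exists i.
Qed.

Lemma back_and_forth (d : continuum -> E) (d' : continuum -> E') :
  exists G, [/\ isometric_graph G, subspace_of (dom G), subspace_of (dom (flip G)),
    forall t, dom G (d t) & forall t, dom (flip G) (d' t)].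
Proof.
have wo := ile.1.
have /choice[nxt nxtP] (p : continuum * (E -> E' -> Prop)) : exists G2, nice_graph p.2 ->
    [/\ nice_graph G2, sub_graph p.2 G2, dom G2 (d p.1) & dom (flip G2) (d' p.1)].
  have [/(nice_graph_extension (d p.1) (d' p.1))[G2 ?]|nG] := pselect (nice_graph p.2).
    by exists G2.
  by exists p.2.
(* Stage [t] closes the union of the earlier graphs and then forces [d t] into the domain and [d' t]
   into the range. The default is the empty graph, so the cut-off in [wo_rec] leaves the union over
   earlier indices unchanged. *)
have [F FE] := wo_rec wo (fun _ _ => False) (fun t F =>
  nxt (t, closure_graph (union_graph (below le0 t) F))).
have {}FE t : F t = nxt (t, closure_graph (union_graph (below le0 t) F)).
  rewrite FE; congr (nxt (_, closure_graph _)).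
  apply/funext => x; apply/funext => y; apply/propext.
  by split=> -[?|[i it]]; [by left|rewrite it => Fi; right; exists i|by left|
    move=> Fi; right; exists i; rewrite ?it].
have FP t : [/\ nice_graph (F t), forall s, below le0 t s -> sub_graph (F s) (F t),
    dom (F t) (d t) & dom (flip (F t)) (d' t)].
  elim/(wo_ind wo): t => t IH.
  have nU : nice_graph (closure_graph (union_graph (below le0 t) F)).
    apply: nice_union_graph => [s /IH[]//|s r st rt|]; last exact: (small_segment ile).
    have [->|sr] := pselect (s = r); first by left.
    have [_ hs _ _] := IH s st; have [_ hr _ _] := IH r rt.
    have /orP[le_sr|le_rs] := wo_total wo s r.
      by left; apply: hr; exact: (wo_le_lt wo).
    by right; apply: hs; apply: (wo_le_lt wo) => // e; apply: sr.
  have [n1 n2 n3 n4] := nxtP (t, _) nU; rewrite -FE in n1 n2 n3 n4.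
  split=> // s st x y Fxy; apply: n2; apply: sub_closure_graph.
  by right; exists s.
have iF t : isometric_graph (F t) by have [[]] := FP t.
have chF s t : sub_graph (F s) (F t) \/ sub_graph (F t) (F s).
  have [->|st] := pselect (s = t); first by left.
  have [_ hs _ _] := FP s; have [_ ht _ _] := FP t.
  have /orP[le_st|le_ts] := wo_total wo s t.
    by left; apply: ht; exact: (wo_le_lt wo).
  by right; apply: hs; apply: (wo_le_lt wo) => // e; apply: st.
have iU := @isometric_union_graph _ _ _ continuum setT F (fun i _ => iF i) (fun i j _ _ => chF i j).
have iG := isometric_closure_graph iU.
have sG : subspace_of (dom (closure_graph (union_graph setT F))).
  by rewrite (dom_closure_graph iU); apply: closure_subspace; exact: linear_dom.
exists (closure_graph (union_graph setT F)); split=> //.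
- exact: closed_graph.
- move=> t; have [_ _ [y Fy] _] := FP t; exists y; apply: sub_closure_graph.
  by right; exists t.
- move=> t; have [_ _ _ [y Fy]] := FP t; exists y; apply: sub_closure_graph.
  by right; exists t.
Qed.
End BackAndForth.

Lemma has_dens_continuum_range (R : realType) (E : completeNormedModType R) :
  has_dens E [set: continuum] -> exists d : continuum -> E, dense (range d).
Proof.
move=> [[D dD]]; rewrite card_eq_le => /andP[/card_le_inj[f [_ finj]] _] _.
exists (fun t => xget 0 [set x | D x /\ f x = t]).
apply/dense_normP => x e /((dense_normP D).1 dD x)[a Da xa]; exists a => //.
exists (f a) => //; case: xgetP => [y -> [Dy]|/(_ a)[]//]; exact: finj.
Qed.

Lemma dense_subspace (R : realType) (E : completeNormedModType R) (D Z : set E) :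
  dense D -> subspace_of Z -> D `<=` Z -> Z = [set: E].
Proof.
move=> /dense_normP dD sZ DZ; apply/seteqP; split=> // x _.
by apply: (subspace_closureP sZ) => e /(dD x)[a /DZ]; exists a.
Qed.

Theorem tightly_filtered_unique (R : realType) (E E' : completeNormedModType R) :
  regular_cardinal continuum ->
  has_dens E [set: continuum] -> has_dens E' [set: continuum] ->
  tightly_sigma_filtered E -> tightly_sigma_filtered E' ->
  extension_property E -> extension_property E' -> isometric E E'.
Proof.
move=> hc /has_dens_continuum_range[d dd] /has_dens_continuum_range[d' dd'].
move=> /tightly_filtered_pushout_filtration[L [le [S fS]]].
move=> /tightly_filtered_pushout_filtration[L' [le' [S' fS']]] extE extE'.
have [le0 ile] := exists_initial_well_order continuum.
have [G [iG sG sG' Gd Gd']] := back_and_forth hc ile fS fS' extE extE' d d'.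
have dG : dom G = [set: E] by apply: dense_subspace dd sG _ => _ [t _ <-].
have dG' : dom (flip G) = [set: E'] by apply: dense_subspace dd' sG' _ => _ [t _ <-].
have [f fi fG] := linear_of_graph iG dG.
exists f => //; apply/seteqP; split=> // y _.
have [x Gxy] : dom (flip G) y by rewrite dG'.
by exists x => //; exact: (graph_fun iG (fG x) Gxy).
Qed.

(** * The transfinite push-out construction *)

(** One inequality for homogeneity is enough: the other one is its instance for the inverse
    scalar. *)
Lemma seminorm_on_le (R : realType) (W : lmodType R) (P : set W) (N : W -> R) : linear_set P ->
  (forall x, P x -> 0 <= N x) -> (forall x y, P x -> P y -> N (x + y) <= N x + N y) ->
  (forall (a : R) x, P x -> N (a *: x) <= `|a| * N x) -> seminorm_on P N.
Proof.
move=> lP N0 ND NZ; split=> // a x Px; apply/eqP; rewrite eq_le NZ//=.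
have Pax : P (a *: x) by exact: linear_setZ.
have [->|an0] := eqVneq a 0; first by rewrite normr0 mul0r scale0r N0//; exact: lP.1.
have := NZ a^-1 _ Pax; rewrite scalerA mulVf// scale1r normfV.
by rewrite mulrC ler_pdivlMr ?normr_gt0// mulrC.
Qed.

Section Tower.
Variables (R : realType) (L : Type) (le : rel L).
Hypothesis wo : wochoice.well_order le.
Let W := L -> {poly R}.

Definition level (a : L) (p : {poly R}) : W := fun b => if `[< b = a >] then p else 0.

Definition level_set (a : L) : set W := range (level a).

(* A datum (w, q) codes a separable one-step extension: w spans a countable set of old vectors,
   {poly R} stands for the span of the new generators 'X^n, and q (s, v) is to be the norm of
   s + sum_i v_i w_i. *)
Definition datum := ((nat -> W) * ({poly R} * {poly R} -> R))%type.

Variable decode : L -> datum.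

Local Notation vspan := (lspan level_set).
Local Notation upto a := [set b | le b a].
Local Notation comb w v := (lincomb idfun w v).

Lemma level_self a p : level a p a = p.
Proof. by rewrite /level; case: asboolP. Qed.

Lemma levelP a c p q : level a (c *: p + q) = c *: level a p + level a q.
Proof.
apply/funext => b; rewrite /level !fctE; case: asboolP => //= _.
by rewrite ?scaler0 addr0.
Qed.

Lemma level0 a : level a 0 = 0.
Proof. by apply/funext => b; rewrite /level; case: asboolP. Qed.

Lemma linear_level_set a : linear_set (level_set a).
Proof.
split; first by exists 0; rewrite ?level0.
by move=> c _ _ [p _ <-] [q _ <-]; exists (c *: p + q); rewrite // levelP.
Qed.

Lemma linear_vspan G : linear_set (vspan G).
Proof. by apply: linear_lspan; exact: linear_level_set. Qed.

Lemma vspan_support G x b : vspan G x -> ~ G b -> x b = 0.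
Proof.
move=> Gx Gb; elim: Gx => // y a _ _ yb Ga [p _ <-].
by rewrite fctE yb /level; case: asboolP => [ba|_]; [rewrite ba in Gb|rewrite addr0].
Qed.

Lemma vspan_top a x : vspan (upto a) x -> vspan (below le a) (x - level a (x a)).
Proof.
move=> Gx; have : vspan (setT `&` upto a) x by rewrite setTI.
move=> /(lspan_top linear_level_set wo)[y [s [Gy [p _ <-] _ ->]]].
rewrite setTI in Gy; rewrite -[(y + _) a]/(y a + level a p a) level_self (vspan_support Gy); last by rewrite /below /= wo_refl.
by rewrite add0r addrK.
Qed.

Lemma vspan_comb G w v : (forall n, vspan G (w n)) -> vspan G (comb w v).
Proof.
move=> Gw; apply: (@linear_set_sum _ _ _ _ (fun i => v`_i *: w i)).
  exact: linear_vspan.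
by move=> i; apply: linear_setZ => //; exact: linear_vspan.
Qed.

Lemma combP (w : nat -> W) (c : R) (u v : {poly R}) : comb w (c *: u + v) = c *: comb w u + comb w v.
Proof. exact: lincombP. Qed.

Lemma combD (w : nat -> W) u v : comb w (u + v) = comb w u + comb w v.
Proof. by have := combP w 1 u v; rewrite !scale1r. Qed.

Lemma combZ (w : nat -> W) c u : comb w (c *: u) = c *: comb w u.
Proof. by have := combP w c u 0; rewrite lincomb0 !addr0. Qed.

Lemma combN (w : nat -> W) u : comb w (- u) = - comb w u.
Proof. by have := combZ w (- 1) u; rewrite !scaleN1r. Qed.

(** The last clause makes the coded norm agree with the norm already built on the old vectors;
    without this agreement the amalgam could shrink them. *)
Definition valid (a : L) (M : W -> R) (d : datum) := [/\ forall n, vspan (below le a) (d.1 n),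
  seminorm_on [set: {poly R} * {poly R}] d.2 & forall v, d.2 (0, v) = M (comb d.1 v)].

(* Data that do not fit the norm already built are replaced by the zero datum, for which the
   new vectors of level a have norm 0. *)
Definition active a (M : W -> R) : datum :=
  if `[< valid a M (decode a) >] then decode a else (fun=> 0, fun=> 0).

(* The push-out norm: x is split into its part below a and its component at a. *)
Definition step a (M : W -> R) (x : W) : R := let d := active a M in
  inf (range (fun v => M (x - level a (x a) + comb d.1 v) + d.2 (x a, - v))).

Section Step.
Variables (a : L) (M : W -> R).
Hypothesis sM : seminorm_on (vspan (below le a)) M.
Let d := active a M.
Let lB := linear_vspan (below le a).

Lemma valid_active : valid a M d.
Proof.
rewrite /d /active; case: asboolP => // _; split=> /= [n|//|v].
- exact: lspan0.
- by split=> [x y _ _|c x _] /=; rewrite ?addr0 ?mulr0.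
- rewrite /lincomb big1 ?(seminorm0 lB sM)// => i _; exact: scaler0.
Qed.

Let term x v := M (x - level a (x a) + comb d.1 v) + d.2 (x a, - v).

Let vw v : vspan (below le a) (comb d.1 v).
Proof. by have [h _ _] := valid_active; exact: vspan_comb. Qed.

Let vx x v : vspan (upto a) x -> vspan (below le a) (x - level a (x a) + comb d.1 v).
Proof. by move=> /vspan_top h; exact: linear_setD. Qed.

Let term_ge0 x v : vspan (upto a) x -> 0 <= term x v.
Proof.
have [_ sq _] := valid_active => Gx; apply: addr_ge0.
  by apply: (seminorm_ge0 lB sM); exact: vx.
by apply: (seminorm_ge0 _ sq) => //; split.
Qed.

Lemma step_le x v : vspan (upto a) x -> step a M x <= term x v.
Proof.
move=> Gx; apply: ge_inf; last by exists v.
by exists 0 => _ [u _ <-]; exact: term_ge0.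
Qed.

Lemma step_lt x e : vspan (upto a) x -> 0 < e -> exists v, term x v < step a M x + e.
Proof.
move=> Gx e0; have [|_ [v _ <-] h] := @inf_adherent _ (range (term x)) _ e0.
  split; first by exists (term x 0), 0.
  by exists 0 => _ [u _ <-]; exact: term_ge0.
by exists v.
Qed.

(** For x below [a], validity turns the infimum into one over M (x + c) + M (c) with c a combination
    of the vectors [d.1], and by the triangle inequality c = 0 is optimal. *)
Lemma step_below x : vspan (below le a) x -> step a M x = M x.
Proof.
move=> Gx; have [_ sq qM] := valid_active.
have Gux : vspan (upto a) x by apply: lspanW Gx => b; exact: wo_ltW.
have xa : x a = 0 by apply: (vspan_support Gx); rewrite /below /= wo_refl.
have tE v : term x v = M (x + comb d.1 v) + M (comb d.1 v).
  by rewrite /term xa level0 subr0 qM combN (seminormN sM).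
apply/eqP; rewrite eq_le; apply/andP; split.
  have := step_le 0 Gux; rewrite tE lincomb0 addr0 (seminorm0 lB sM); lra.
apply/ler_addgt0Pr => e /(step_lt Gux)[v]; rewrite tE.
have := seminormB lB sM (linear_setD lB Gx (vw v)) (vw v); rewrite addrK; lra.
Qed.

Lemma seminorm_step : seminorm_on (vspan (upto a)) (step a M).
Proof.
have [_ sq qM] := valid_active; have lU := linear_vspan (upto a).
apply: seminorm_on_le => // [x Gx|x y Gx Gy|c x Gx].
- apply: lb_le_inf; first by exists (term x 0), 0.
  by move=> _ [v _ <-]; exact: term_ge0.
- apply/ler_addgt0Pr => e e0; have e20 : 0 < e / 2 by rewrite divr_gt0.
  have [u hu] := step_lt Gx e20; have [v hv] := step_lt Gy e20.
  have := step_le (u + v) (linear_setD lU Gx Gy); move: hu hv; rewrite /term.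
  have -> : x + y - level a ((x + y) a) + comb d.1 (u + v) =
    (x - level a (x a) + comb d.1 u) + (y - level a (y a) + comb d.1 v).
    rewrite combD [RHS]addrACA; congr (_ + _); rewrite [RHS]addrACA; congr (_ + _).
    by have := levelP a 1 (x a) (y a); rewrite !scale1r -opprD => <-.
  have := sM.1 _ _ (vx u Gx) (vx v Gy).
  have := sq.1 (x a, - u) (y a, - v) I I.
  rewrite opprD -[_ + (y a, _)]/(x a + y a, - u - v) fctE; lra.
- apply/ler_addgt0Pr => e e0.
  have c0 : 0 < `|c| + 1 by rewrite ltr_wpDl.
  have [u hu] := step_lt Gx (divr_gt0 e0 c0).
  have := step_le (c *: u) (linear_setZ c lU Gx).
  have -> : term (c *: x) (c *: u) = `|c| * term x u.
    rewrite /term mulrDr -sM.2; last exact: vx.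
    rewrite -sq.2// -[c *: (_, _)]/(c *: x a, c *: - u) scalerN; congr (M _ + _).
    rewrite combZ scalerDr scalerBr; congr (_ - _ + _).
    by have := levelP a c (x a) 0; rewrite level0 !addr0.
  have h1 : `|c| * term x u <= `|c| * (step a M x + e / (`|c| + 1)).
    by rewrite ler_wpM2l// ltW.
  have h2 : `|c| * (e / (`|c| + 1)) <= e.
    by rewrite mulrCA ler_piMr// ?ltW// ltr_pdivrMr// mul1r ltrDl.
  by move: h1; rewrite mulrDr; lra.
Qed.
End Step.

(* G b is defined on the vectors supported below b; as the supports are finite, the value at x
   is computed by the step at any a < b that bounds the support, and does not depend on a. *)
Lemma tower_exists : exists G : L -> W -> R, forall b,
  seminorm_on (vspan (below le b)) (G b) /\
  forall a x, below le b a -> vspan (upto a) x -> G b x = step a (G a) x.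
Proof.
pose stepG b (H : L -> W -> R) x :=
  if pselect (exists a, below le b a /\ vspan (upto a) x) is left h
  then step (projT1 (cid h)) (H (projT1 (cid h))) x else 0.
have [G GE] := wo_rec wo (fun=> 0) stepG.
exists G; elim/(wo_ind wo) => b IH.
have coh a a' x : below le b a -> below le b a' -> vspan (upto a) x -> vspan (upto a') x ->
    step a (G a) x = step a' (G a') x.
  wlog aa : a a' / le a a'.
    move=> H ab ab' xa xa'; have /orP[h|h] := wo_total wo a a'; first exact: H.
    by apply/esym; exact: H.
  move=> ab ab' xa xa'; have [<-//|ne] := pselect (a = a').
  have la : below le a' a by exact: (wo_le_lt wo).
  have [sG' GG'] := IH a' ab'.
  rewrite (step_below sG'); first by rewrite (GG' a).
  by apply: lspanW xa => c /= ca; exact: (wo_le_lt_trans wo ca).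
have GbE a x : below le b a -> vspan (upto a) x -> G b x = step a (G a) x.
  move=> ab xa; rewrite GE /stepG; case: pselect => [h|]; last by case; exists a.
  have [hb hx] := projT2 (cid h); move: hb hx; set a' := projT1 _ => hb hx.
  by rewrite hb; exact: coh.
(* Handled apart: for the least [b] there is no bounding index, and [stepG] takes its default
   value. *)
have G0 : G b 0 = 0.
  rewrite GE /stepG; case: pselect => // h.
  have [hb hx] := projT2 (cid h); move: hb hx; set a' := projT1 _ => hb hx.
  by rewrite hb (seminorm0 (linear_vspan _) (seminorm_step (IH _ hb).1)).
split=> //.
have up x a : vspan (below le b `&` upto a) x -> forall c, le a c -> vspan (upto c) x.
  by move=> xa c ac; apply: lspanW xa => e [_ /= ea]; exact: (wo_trans wo ea).
have lvl x : vspan (below le b) x -> x = 0 \/ exists2 a, below le b a & forall c, le a c -> vspan (upto c) x.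
  by move=> /(lspan_max wo)[|[a ab /up]]; [left|right; exists a].
split=> [x y /lvl + /lvl|c x /lvl[->|[a ab xa]]].
- move=> [->|[a ab xa]] [->|[a' ab' ya]]; rewrite ?add0r ?addr0 ?G0 ?addr0 ?add0r//.
  have [m [mb am am']] : exists m, [/\ below le b m, le a m & le a' m].
    have /orP[h|h] := wo_total wo a a'; [exists a'|exists a]; split=> //; exact: wo_refl.
  rewrite !(GbE m)//; do ?[exact: xa|exact: ya].
    exact: (seminorm_step (IH m mb).1).1 (xa _ am) (ya _ am').
  by apply: (linear_setD (linear_vspan _)); [exact: xa|exact: ya].
- by rewrite scaler0 G0 mulr0.
- have xa' := xa a (wo_refl wo a); rewrite !(GbE a)//.
    exact: (seminorm_step (IH a ab).1).2.
  exact: linear_setZ (linear_vspan _) xa'.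
Qed.
End Tower.

(** * Stages of the completed tower *)

Section TowerCompletion.
Variables (R : realType) (L : Type) (le : rel L) (top : L).
Hypotheses (wo : wochoice.well_order le) (topP : is_greatest le top).
Let W := L -> {poly R}.
Variables (decode : L -> datum R L) (G : L -> W -> R).
Hypothesis GP : forall b, seminorm_on (lspan (@level_set R L) (below le b)) (G b) /\
  forall a x, below le b a -> lspan (@level_set R L) [set c | le c a] x ->
    G b x = step le decode a (G a) x.
Variables (E : completeNormedModType R) (j : W -> E).
Local Notation vspan := (lspan (@level_set R L)).
Local Notation upto a := [set b | le b a].
Local Notation comb w v := (lincomb idfun w v).
Hypothesis jL : forall (c : R) x y, vspan (below le top) x -> vspan (below le top) y ->
  j (c *: x + y) = c *: j x + j y.
Hypothesis jN : forall x, vspan (below le top) x -> `|j x| = G top x.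
Hypothesis jdense : forall z e, 0 < e -> exists2 x, vspan (below le top) x & `|z - j x| < e.

Lemma below_le_top a : below le a `<=` below le top.
Proof. by apply: belowS => //; exact: topP. Qed.

Lemma upto_below a b : below le b a -> upto a `<=` below le b.
Proof. by move=> ab c /= ca; exact: (wo_le_lt_trans wo ca). Qed.

Let lT := linear_vspan R (below le top).

Let j0 : j 0 = 0.
Proof.
apply/normr0_eq0; rewrite jN; last exact: lspan0.
exact: seminorm0 (GP top).1.
Qed.

Let jD x y : vspan (below le top) x -> vspan (below le top) y -> j (x + y) = j x + j y.
Proof. by move=> Tx Ty; have := jL 1 Tx Ty; rewrite !scale1r. Qed.

Let jZ c x : vspan (below le top) x -> j (c *: x) = c *: j x.
Proof. by move=> Tx; have := jL c Tx (lspan0 _ _); rewrite j0 !addr0. Qed.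

Let jB x y : vspan (below le top) x -> vspan (below le top) y -> j (x - y) = j x - j y.
Proof.
by move=> Tx Ty; rewrite jD//; [rewrite -scaleN1r jZ// scaleN1r|exact: linear_setN].
Qed.

Lemma norm_below a x : vspan (below le a) x -> `|j x| = G a x.
Proof.
move=> ax; rewrite jN; last by apply: lspanW ax; exact: below_le_top.
have [->//|ne] := pselect (a = top).
have at_ : below le top a by exact: (wo_le_lt wo).
rewrite ((GP top).2 a)//; last by apply: lspanW ax => c; exact: wo_ltW.
exact: (step_below wo decode (GP a).1).
Qed.

Lemma norm_upto a x : below le top a -> vspan (upto a) x -> `|j x| = step le decode a (G a) x.
Proof.
move=> at_ ax; rewrite jN; first exact: (GP top).2.
by apply: lspanW ax; exact: upto_below.
Qed.

Definition stage a : set E := closure (j @` vspan (below le a)).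

Lemma linear_jimage (P : set W) : linear_set P -> P `<=` vspan (below le top) -> linear_set (j @` P).
Proof.
move=> lP PT; split; first by exists 0; [exact: lP.1|exact: j0].
move=> c _ _ [x Px <-] [y Py <-]; exists (c *: x + y); first exact: lP.2.
by rewrite jL//; exact: PT.
Qed.

Lemma stage_subspace a : subspace_of (stage a).
Proof.
apply/closure_subspace/linear_jimage; first exact: linear_vspan.
by move=> x; apply: lspanW; exact: below_le_top.
Qed.

Lemma stageW a b : le a b -> stage a `<=` stage b.
Proof.
move=> ab; apply: closureS => _ [x ax <-]; exists x => //.
by apply: lspanW ax; exact: belowS.
Qed.

Section Successor.
Variable a : L.
Hypothesis at_ : below le top a.
Let d := active le decode a (G a).
Let dV := valid_active decode (GP a).1.
Let la := linear_vspan R (upto a).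

(** The separable piece of level [a], before closure. It contains the old vectors [comb d.1 v] along
    with the new ones, because the push-out corrections have to lie in it. *)
Definition new_set : set W := [set x | exists p v, x = level a p + comb d.1 v].

Lemma linear_new_set : linear_set new_set.
Proof.
split; first by exists 0, 0; rewrite level0 lincomb0 addr0.
move=> c _ _ [p [v ->]] [p' [v' ->]]; exists (c *: p + p'), (c *: v + v').
by rewrite levelP combP scalerDr addrACA.
Qed.

Lemma upto_top : upto a `<=` below le top.
Proof. exact: upto_below. Qed.

Lemma comb_below v : vspan (below le a) (comb d.1 v).
Proof. by case: dV => h _ _; exact: vspan_comb. Qed.

Lemma below_upto x : vspan (below le a) x -> vspan (upto a) x.
Proof. by apply: lspanW => c; exact: wo_ltW. Qed.

Lemma level_upto p : vspan (upto a) (level a p).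
Proof. by apply: (lspan_gen (a := a)); [exact: wo_refl|exists p]. Qed.

Lemma new_upto : new_set `<=` vspan (upto a).
Proof.
move=> _ [p [v ->]]; apply: (linear_setD la); first exact: level_upto.
exact/below_upto/comb_below.
Qed.

(** A nearly optimal parameter [u] in the infimum for x + s gives the correction [comb d.1 (v + u)],
    which is below [a] and in [new_set]. What remains of s is [level a p - comb d.1 u], and using
    the same [u] for it costs exactly [d.2 (p, - u)]. *)
Lemma new_amalgamated : amalgamated (closure (j @` new_set) `&` closure (j @` vspan (below le a)))
  (j @` vspan (below le a)) (j @` new_set).
Proof.
move=> _ _ [x ax <-] [_ [p [v ->]] <-] e e0.
set s := level a p + comb d.1 v.
have ns : new_set s by exists p, v.
have T y : vspan (upto a) y -> vspan (below le top) y by apply: lspanW; exact: upto_top.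
have xs : vspan (upto a) (x + s) by apply: (linear_setD la); [exact: below_upto|exact: new_upto].
have [u] := step_lt wo decode (GP a).1 xs e0.
have xsa : (x + s) a = p.
  rewrite -[LHS]/(x a + (level a p a + comb d.1 v a)) level_self.
  by rewrite !(@vspan_support _ _ (below le a)) ?add0r ?addr0//;
     try exact: comb_below; rewrite /below /= wo_refl.
have -> : x + s - level a ((x + s) a) + comb d.1 u = x + comb d.1 (v + u).
  by rewrite xsa /s combD addrA [x + _ + _]addrAC addrK !addrA.
rewrite xsa -norm_upto// jD; [|exact/T/below_upto|exact/T/new_upto].
have bx : vspan (below le a) (x + comb d.1 (v + u)).
  by apply: (linear_setD (linear_vspan _ _)) => //; exact: comb_below.
rewrite -(norm_below bx) => h.
have rb : vspan (below le a) (comb d.1 (v + u)) by exact: comb_below.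
have rn : new_set (comb d.1 (v + u)) by exists 0, (v + u); rewrite level0 add0r.
exists (j (comb d.1 (v + u))).
  by split; apply: subset_closure; exists (comb d.1 (v + u)).
rewrite -jD; [|exact/T/below_upto|exact/T/below_upto].
rewrite -jB; [|exact/T/new_upto|exact/T/new_upto].
apply: le_lt_trans h; rewrite lerD2l.
have su : vspan (upto a) (s - comb d.1 (v + u)).
  by apply: (linear_setB la); [exact: new_upto|exact: new_upto].
rewrite (norm_upto at_ su); have := step_le wo decode (GP a).1 u su; rewrite -/d.
move=> /le_trans; apply.
have -> : s - comb d.1 (v + u) = level a p - comb d.1 u.
  by rewrite /s combD opprD addrA addrK.
have -> : (level a p - comb d.1 u) a = p.
  rewrite -[LHS]/(level a p a - comb d.1 u a) level_self.
  by rewrite (vspan_support (comb_below u)) ?subr0// /below /= wo_refl.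
by rewrite addrAC subrK subrr (seminorm0 (linear_vspan _ _) (GP a).1) add0r.
Qed.

Lemma new_separable : separable_set (closure (j @` new_set)).
Proof.
have sN : subspace_of (cspan (range (fun n => j (level a 'X^n)) `|` range (fun n => j (d.1 n)))).
  exact: cspan_subspace.
apply: separable_subset (separable_cspan (_ : countable
  (range (fun n => j (level a 'X^n)) `|` range (fun n => j (d.1 n))))) _.
  by apply: countableU; apply: sub_countable (card_image_le _ _) _; exact: countableP.
have lN := subspace_linear sN; have l0 := linear_vspan R (upto a).
have T y : vspan (upto a) y -> vspan (below le top) y by apply: lspanW; exact: upto_top.
have jcomb (w : nat -> W) (v : {poly R}) : (forall n, vspan (upto a) (w n)) ->
    j (comb w v) = \sum_(i < size v) v`_i *: j (w i).
  move=> aw; rewrite /lincomb; elim: (size v) => [|n IH]; first by rewrite !big_ord0 j0.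
  rewrite !big_ord_recr /= jD ?IH ?jZ//; try exact: T.
    apply/T/(@linear_set_sum _ _ _ _ (fun i => v`_i *: w i)) => // i.
    exact: (linear_setZ _ l0).
  exact/T/(linear_setZ _ l0).
apply: sub_closure_subspace => // _ [_ [p [v ->]] <-].
rewrite jD; [|exact/T/level_upto|exact/T/below_upto/comb_below].
have -> : level a p = comb (fun n => level a 'X^n) p.
  rewrite -{1}[p]coefK poly_def (big_morph (level a) (id1 := 0) (op1 := +%R)) ?level0//.
    apply: eq_bigr => i _; have := levelP a p`_i 'X^i 0.
    by rewrite level0 !addr0.
  by move=> q r; have := levelP a 1 q r; rewrite !scale1r.
rewrite !jcomb => [|n|n]; last 2 first.
- by case: dV => h _ _; exact/below_upto/h.
- exact: level_upto.
have [h _ _] := dV.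
apply: (linear_setD lN).
  apply: (@linear_set_sum _ _ _ _ (fun i => p`_i *: j (level a 'X^i))) => // i.
  by apply: (linear_setZ _ lN); apply: sub_cspan; left; exists i.
apply: (@linear_set_sum _ _ _ _ (fun i => v`_i *: j (d.1 i))) => // i.
by apply: (linear_setZ _ lN); apply: sub_cspan; right; exists i.
Qed.

Lemma stage_succ b : is_succ le a b -> posex (stage b) (stage a).
Proof.
move=> [ab bmin].
have uB : below le b `<=` upto a.
  move=> c cb; apply: contrapT => /negP/bmin bc; by rewrite /below /= bc in cb.
have T y : vspan (upto a) y -> vspan (below le top) y by apply: lspanW; exact: upto_top.
have ln : linear_set (j @` new_set) by apply: linear_jimage linear_new_set _ => y /new_upto/T.
have lb : linear_set (j @` vspan (below le a)).
  by apply: linear_jimage (linear_vspan _ _) _ => y; apply: lspanW; exact: below_le_top.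
exists (closure (j @` new_set)); first exact: new_separable.
suff -> : stage b = closure (sumset (j @` new_set) (j @` vspan (below le a))).
  exact: pushout_closure new_amalgamated.
congr closure; apply/seteqP; split=> [_ [x bx <-]|_ [_ [s ns <-] [_ [x ax <-] <-]]].
  have ux : vspan (upto a) x by apply: lspanW bx.
  have ax := vspan_top wo ux.
  exists (j (level a (x a))).
    by exists (level a (x a)) => //; exists (x a), 0; rewrite lincomb0 addr0.
  exists (j (x - level a (x a))); first by exists (x - level a (x a)).
  by rewrite -jD; [rewrite addrC subrK|exact/T/level_upto|exact/T/below_upto].
exists (s + x); last by rewrite jD//; [exact/T/new_upto|exact/T/below_upto].
apply: (linear_setD (linear_vspan _ _)).
  by apply: lspanW (new_upto ns); exact: upto_below.
by apply: lspanW ax; apply: belowS => //; exact: wo_ltW.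
Qed.
End Successor.

(** Supports are finite, so a vector supported below a limit is already supported below an earlier
    index. *)
Lemma stage_limit b : is_limit le b -> stage b = closure (\bigcup_(a in below le b) stage a).
Proof.
move=> [nleast nsucc]; apply/seteqP; split; last first.
  apply: sub_closure_subspace (stage_subspace _) _ => x [a ab].
  by apply: stageW; exact: wo_ltW.
apply: closureS => _ [x bx <-].
have nxt a : below le b a -> exists2 c, below le b c & upto a `<=` below le c.
  move=> ab; have [c ac cb] := wo_succ wo ab; exists c; last exact: (upto_below ac.1).
  by apply: (wo_le_lt wo cb) => e; apply: (nsucc a); rewrite -e.
have [a ab ax] : exists2 a, below le b a & vspan (upto a) x.
  have [->|[a ab ax]] := lspan_max wo bx; last by exists a => //; apply: lspanW ax => c [].
  move: nleast => /existsNP[a /negP ab]; exists a => //; exact: lspan0.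
have [c cb ac] := nxt a ab; exists c => //; apply: subset_closure; exists x => //.
exact: lspanW ax.
Qed.

Lemma stage_least b : is_least le b -> stage b = [set 0].
Proof.
move=> lb; apply/seteqP; split=> [|_ ->]; last exact: (subspace_linear (stage_subspace b)).1.
apply: sub_closure_subspace (subspace_set0 E) _ => _ [x bx <-].
suff -> : x = 0 by rewrite j0.
by case: bx => // y a s _; rewrite /below /= lb.
Qed.

Lemma stage_top : stage top = [set: E].
Proof.
apply/seteqP; split=> // z _; apply/closure_normP => e /(jdense z)[x Tx zx].
by exists (j x) => //; exists x.
Qed.

Lemma stage_tightly_filtered : tightly_sigma_filtered E.
Proof.
exists L, le, stage; split; first by split=> //; exists top.
split.
- by split; [exact: stage_subspace|move=> a b; exact: stageW].
- exact: stage_least.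
- move=> a gra; have -> : a = top by apply: (wo_antisymmetric wo); [exact: topP|exact: gra].
  exact: stage_top.
- move=> a b ab; apply: stage_succ => //; exact: (wo_lt_le_trans wo ab.1 (topP b)).
- exact: stage_limit.
Qed.

(** * Realising a posex extension at one level of the tower *)

Section LevelExtension.
Variables (X Y : completeNormedModType R) (u : {linear X -> E}) (v : {linear X -> Y}).
Variables (S : set Y) (sg : nat -> Y) (w : nat -> W) (a b : L).
Hypotheses (iu : isometric_embedding u) (iv : isometric_embedding v).
Hypotheses (po : pushout [set: Y] S (range v)) (Ssg : forall n, S (sg n)).
Hypothesis sg_dense : S `<=` closure (range (lincomb idfun sg)).
Hypotheses (ua : forall x, stage a (u x)) (wa : forall n, vspan (below le a) (w n)).
Hypothesis w_dense : u @` (v @^-1` S) `<=` closure (range (fun n => j (w n))).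
Hypotheses (bt : below le top b) (ab : le a b).

Let sS : subspace_of S. Proof. by case: po => -[]. Qed.
Let lS : linear_set S. Proof. exact: subspace_linear. Qed.
Let csg (p : {poly R}) : Y := lincomb idfun sg p.
Let csgP c p q : csg (c *: p + q) = c *: csg p + csg q. Proof. exact: lincombP. Qed.
Let csg0 : csg 0 = 0. Proof. exact: lincomb0. Qed.
Let jw (c : {poly R}) : E := j (comb w c).
Let wt c : vspan (below le top) (comb w c).
Proof. by apply: vspan_comb => n; apply: lspanW (wa n); exact: below_le_top. Qed.
Let jwP c p q : jw (c *: p + q) = c *: jw p + jw q.
Proof. by rewrite /jw combP jL. Qed.
Let jw0 : jw 0 = 0. Proof. by rewrite /jw lincomb0 j0. Qed.
Let csgD p q : csg (p + q) = csg p + csg q.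
Proof. by have := csgP 1 p q; rewrite !scale1r. Qed.
Let csgZ c p : csg (c *: p) = c *: csg p.
Proof. by have := csgP c p 0; rewrite csg0 !addr0. Qed.
Let jwD p q : jw (p + q) = jw p + jw q.
Proof. by have := jwP 1 p q; rewrite !scale1r. Qed.
Let jwZ c p : jw (c *: p) = c *: jw p.
Proof. by have := jwP c p 0; rewrite jw0 !addr0. Qed.
Let Scsg p : S (csg p).
Proof. by apply: (@linear_set_sum _ _ S _ (fun i => p`_i *: sg i)) => // i; exact: linear_setZ. Qed.

(* The norm of the sum of [comb sg sc.1] and [comb w sc.2] in the amalgam of S and E over
   their common part v^-1(S). *)
Definition gap (sc : {poly R} * {poly R}) : R :=
  inf [set `|j (comb w sc.2) + u x| + `|lincomb idfun sg sc.1 - v x| | x in v @^-1` S].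

Let S0 : (v @^-1` S) 0. Proof. by rewrite /preimage /= raddf0; exact: lS.1. Qed.

Let gap_le sc x : S (v x) -> gap sc <= `|jw sc.2 + u x| + `|csg sc.1 - v x|.
Proof.
move=> Sx; apply: ge_inf; last by exists x.
by exists 0 => _ [y _ <-]; rewrite addr_ge0.
Qed.

Let gap_lt sc e : 0 < e -> exists2 x, S (v x) & `|jw sc.2 + u x| + `|csg sc.1 - v x| < gap sc + e.
Proof.
move=> e0; have [|_ [x Sx <-] h] := @inf_adherent _ [set `|jw sc.2 + u x| + `|csg sc.1 - v x| | x in v @^-1` S] _ e0.
  split; first by eexists; exists 0; first exact: S0.
  by exists 0 => _ [y _ <-]; rewrite addr_ge0.
by exists x.
Qed.

Lemma gap_seminorm : seminorm_on setT gap.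
Proof.
apply: seminorm_on_le => // [sc _|sc sc' _ _|c sc _].
- apply: lb_le_inf; first by eexists; exists 0; first exact: S0.
  by move=> _ [x _ <-]; rewrite addr_ge0.
- apply/ler_addgt0Pr => e e0; have e20 : 0 < e / 2 by rewrite divr_gt0.
  have [x Sx hx] := gap_lt sc e20; have [y Sy hy] := gap_lt sc' e20.
  have Sxy : S (v (x + y)) by rewrite raddfD; exact: linear_setD.
  have := gap_le (sc + sc') Sxy; rewrite /= jwD csgD (raddfD u) (raddfD v) opprD addrACA [csg _ + _ + _]addrACA.
  have := ler_normD (jw sc.2 + u x) (jw sc'.2 + u y).
  by have := ler_normD (csg sc.1 - v x) (csg sc'.1 - v y); lra.
- apply/ler_addgt0Pr => e e0.
  have c0 : 0 < `|c| + 1 by rewrite ltr_wpDl.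
  have [x Sx hx] := gap_lt sc (divr_gt0 e0 c0).
  have Scx : S (v (c *: x)) by rewrite linearZ; exact: linear_setZ.
  have uc : u (c *: x) = c *: u x by rewrite linearZZ.
  have vc : v (c *: x) = c *: v x by rewrite linearZZ.
  have := gap_le (c *: sc) Scx; rewrite /= jwZ csgZ uc vc -scalerDr -scalerBr !normrZ -mulrDr.
  have h1 : `|c| * (`|jw sc.2 + u x| + `|csg sc.1 - v x|) <= `|c| * (gap sc + e / (`|c| + 1)).
    by rewrite ler_wpM2l// ltW.
  have h2 : `|c| * (e / (`|c| + 1)) <= e.
    by rewrite mulrCA ler_piMr// ?ltW// ltr_pdivrMr// mul1r ltrDl.
  by move: h1; rewrite mulrDr; lra.
Qed.

(** Since [u] and [v] preserve norms, a correction x costs in the second term at least what it saves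
    in the first. This is the consistency clause that makes the datum valid. *)
Lemma gap_right c : gap (0, c) = `|j (comb w c)|.
Proof.
apply/eqP; rewrite eq_le; apply/andP; split.
  by have := gap_le (0, c) S0; rewrite /= (raddf0 u) (raddf0 v) csg0 subr0 normr0 !addr0.
apply/ler_addgt0Pr => e /(gap_lt (0, c))[x _]; rewrite /= csg0 sub0r normrN iv -(iu x).
by have := ler_normD (jw c + u x) (- u x); rewrite addrK normrN /jw; lra.
Qed.

Hypothesis db : decode b = (w, gap).

Let activeE : active le decode b (G b) = (w, gap).
Proof.
rewrite /active db asboolT//; split=> /= [n||c].
- by apply: lspanW (wa n); exact: belowS.
- exact: gap_seminorm.
- rewrite gap_right (norm_below (a := b))//.
  by apply: vspan_comb => n; apply: lspanW (wa n); exact: belowS.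
Qed.

Let wb c : vspan (below le b) (comb w c).
Proof. by apply: vspan_comb => n; apply: lspanW (wa n); exact: belowS. Qed.
Let lb := linear_vspan R (upto b).
Let ub x : vspan (below le b) x -> vspan (upto b) x.
Proof. by apply: lspanW => c; exact: wo_ltW. Qed.
Let lev p : vspan (upto b) (level b p).
Proof. by apply: (lspan_gen (a := b)); [exact: wo_refl|exists p]. Qed.
Let T x : vspan (upto b) x -> vspan (below le top) x.
Proof. by apply: lspanW; exact: upto_below. Qed.
Let at_b x p : vspan (below le b) x -> (level b p + x) b = p.
Proof.
move=> bx; rewrite -[LHS]/(level b p b + x b) level_self (vspan_support bx) ?addr0//.
by rewrite /below /= wo_refl.
Qed.

(** [u r] is approximated by some [j (w n)]. With the parameter 'X^n the part below [b] cancels in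
    [step], leaving [gap (p, - 'X^n)], for whose infimum r is a competitor. *)
Let level_dist p r : S (v r) -> `|j (level b p) - u r| <= `|csg p - v r|.
Proof.
move=> Sr; apply/ler_addgt0Pr => e e0; have e20 : 0 < e / 2 by rewrite divr_gt0.
have /w_dense/closure_normP/(_ _ e20)[_ [n _ <-] rn] : (u @` (v @^-1` S)) (u r) by exists r.
have wE : w n = comb w 'X^n by rewrite lincombX.
have bw : vspan (below le b) (- comb w 'X^n) by exact: linear_setN (linear_vspan _ _) (wb _).
have bu : vspan (upto b) (level b p - comb w 'X^n).
  by apply: (linear_setD lb); [exact: lev|exact: ub].
have := step_le wo decode (GP b).1 'X^n bu.
rewrite activeE at_b// [level b p - _ - _]addrAC subrr sub0r addNr.
rewrite (seminorm0 (linear_vspan _ _) (GP b).1) add0r /= -norm_upto// jB; [|exact/T/lev|exact/T/ub/wb].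
have jwN c : jw (- c) = - jw c by have := jwZ (- 1) c; rewrite !scaleN1r.
have := gap_le (p, - 'X^n) Sr; rewrite /= jwN /jw -wE [- j (w n) + _]addrC.
have := ler_normD (j (level b p) - j (w n)) (j (w n) - u r); rewrite addrA subrK.
by rewrite (distrC (j (w n)) (u r)); lra.
Qed.

(** The norm in [E] is bounded by the norm in [Y] through a push-out correction and [level_dist].
    The reverse bound unwinds the infima of [step] and [gap] near their optima. *)
Let level_norm p x : `|csg p + v x| = `|j (level b p) + u x|.
Proof.
apply/eqP; rewrite eq_le; apply/andP; split; apply/ler_addgt0Pr => e e0; last first.
  have vx : range v (v x) by exists x.
  have [k [Sk kv]] := pushout_amalgamated po vx (Scsg p) e0.
  case: kv Sk => r _ <- Sr; rewrite -raddfD iv -iu raddfD [v x + _]addrC.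
  have := level_dist p Sr; have := ler_normD (j (level b p) - u r) (u x + u r).
  by rewrite [u x + u r]addrC addrA subrK; lra.
have jwN c : jw (- c) = - jw c by have := jwZ (- 1) c; rewrite !scaleN1r.
(* Four errors: replacing [u x] by [j x0] is paid twice, the infima of [step] and [gap] once
   each. *)
have e40 : 0 < e / 4 by rewrite divr_gt0.
have /closure_normP/(_ _ e40)[_ [x0 ax0 <-] xx0] := @ua x.
have bx0 : vspan (below le b) x0 by apply: lspanW ax0; exact: belowS.
have bs : vspan (upto b) (level b p + x0).
  by apply: (linear_setD lb); [exact: lev|exact: ub].
have [c] := step_lt wo decode (GP b).1 bs e40.
rewrite activeE at_b// [level b p + _ - _]addrAC subrr add0r /= -norm_upto//.
have bxc : vspan (below le b) (x0 + comb w c).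
  by apply: (linear_setD (linear_vspan _ _)) => //.
rewrite -(norm_below (a := b))//.
have -> : j (x0 + comb w c) = j x0 + j (comb w c) by apply: jD; [exact/T/ub|exact: wt].
have -> : j (level b p + x0) = j (level b p) + j x0 by apply: jD; [exact/T/lev|exact/T/ub].
have [x' Sx'] := gap_lt (p, - c) e40; rewrite /= jwN /jw => h1 h2.
have h3 := ler_normD (csg p - v x') (v x' + v x); rewrite addrA subrK in h3.
have h4 : `|v x' + v x| = `|u x' + u x| by rewrite -raddfD iv -iu raddfD.
have h5 := ler_normD (- j (comb w c) + u x') (j x0 + j (comb w c)).
have h6 := ler_normD (- j (comb w c) + u x' + (j x0 + j (comb w c))) (u x - j x0).
have h7 := ler_normD (j (level b p) + u x) (j x0 - u x).
have e6 : - j (comb w c) + u x' + (j x0 + j (comb w c)) + (u x - j x0) = u x' + u x.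
  rewrite [- _ + u x']addrC [j x0 + _]addrC (addrA (u x' - _) _ (j x0)) subrK -addrA; congr (_ + _).
  by rewrite addrC subrK.
have e7 : j (level b p) + u x + (j x0 - u x) = j (level b p) + j x0.
  by rewrite [j x0 - _]addrC addrA addrK.
rewrite e6 in h6; rewrite e7 (distrC (j x0)) in h7; rewrite h4 in h3.
by move: h1 h2 h3 h5 h6 h7 xx0; clear e6 e7 h4; lra.
Qed.

(** The vectors of level [b] are sent the combinations of [sg] with the same coefficients, which
    gives an isometry on a dense subset of [Y]; p = 0 yields the compatibility with [u]. *)
Lemma level_extension : exists2 f : {linear Y -> E}, isometric_embedding f & forall x, f (v x) = u x.
Proof.
pose H y z := exists p x, y = csg p + v x /\ z = j (level b p) + u x.
have jl0 : j (level b 0) = 0 by rewrite level0 j0.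
have iH : isometric_graph H.
  split; first by exists 0, 0; rewrite csg0 !raddf0 jl0 !addr0.
    move=> c _ _ _ _ [p [x [-> ->]]] [p' [x' [-> ->]]]; exists (c *: p + p'), (c *: x + x').
    rewrite csgP levelP jL ?linearP; [|exact/T/lev|exact/T/lev].
    by rewrite !scalerDr; split; rewrite addrACA.
  by move=> _ _ [p [x [-> ->]]]; exact: level_norm.
have [|f fi fH] := linear_of_graph (isometric_closure_graph iH).
  rewrite (dom_closure_graph iH); case: po => _ _ -> _.
  apply/seteqP; split; first by apply: closureS => y [z [p [x [-> _]]]]; exists (csg p) => //; exists (v x) => //; exists x.
  have lH : linear_set (dom H) := linear_dom iH.
  apply: sub_closure_subspace; first exact: closure_subspace.
  move=> _ [s Ss [_ [x _ <-] <-]]; apply/closure_normP => e e0.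
  have /closure_normP/(_ e e0)[_ [p _ <-] sp] := sg_dense Ss.
  exists (csg p + v x); first by exists (j (level b p) + u x), p, x.
  by rewrite opprD addrACA subrr addr0.
exists f => // x; apply: (graph_fun (isometric_closure_graph iH) (fH _)).
by apply: sub_closure_graph; exists 0, x; rewrite csg0 jl0 !add0r.
Qed.
End LevelExtension.

End TowerCompletion.

(** * Density character *)

(** A point is determined by a sequence in [D] approaching it at rate 2^-n, and there are at most c
    such sequences. *)
Lemma card_le_dense (R : realType) (E : completeNormedModType R) (D : set E) :
  dense D -> D #<= cc -> [set: E] #<= cc.
Proof.
move=> /dense_normP dD /card_le_inj[f [_ finj]].
have /choice[u uP] x : exists u : nat -> E, forall n, D (u n) /\ `|x - u n| < 2^-1 ^+ n.
  have /choice[u uP] n : exists d, D d /\ `|x - d| < 2^-1 ^+ n.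
    by have [|d Dd xd] := dD x (2^-1 ^+ n); [rewrite exprn_gt0// invr_gt0|exists d].
  by exists u.
apply: card_le_trans (continuum_seqs (card_lexx cc)).
apply: (@card_le_of_inj _ _ _ _ (fun x n => f (u x n))) => // x y _ _ xy.
apply/eqP; rewrite -subr_eq0 -normr_eq0 eq_le normr_ge0 andbT.
apply/ler_addgt0Pr => e e0; have [n hn] := half_expn_lt (divr_gt0 e0 (ltac:(lra) : 0 < 2 :> R)).
have [Dx xu] := uP x n; have [Dy yu] := uP y n.
have e1 : u x n = u y n by apply: finj => //; exact: (congr1 (fun h => h n) xy).
rewrite e1 in xu; have := ler_normD (x - u y n) (u y n - y).
by rewrite addrA subrK (distrC (u y n)); lra.
Qed.

(* Extending the identity of E over E (+)_1 R would give a non-injective isometry. *)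
Lemma extension_not_dens_lt (R : realType) (E : completeNormedModType R) :
  extension_property E -> ~ dens_lt E cc.
Proof.
move=> extE dE.
pose W := (E * R^o)%type.
pose N (x : W) : R := `|x.1| + `|x.2|.
have lT : linear_set [set: W] by [].
have sN : seminorm_on [set: W] N.
  split=> [x y _ _|a x _]; rewrite /N /=.
    by have := ler_normD x.1 y.1; have := ler_normD x.2 y.2; lra.
  by rewrite normrZ normrM mulrDr.
have [Y [j [jL jN jd]]] := seminorm_completion lT sN.
have {}jL a x y : j (a *: x + y) = a *: j x + j y by exact: jL.
have {}jN x : `|j x| = N x by exact: jN.
have j0 : j 0 = 0 by apply/normr0_eq0; rewrite jN /N !normr0 addr0.
have jD x y : j (x + y) = j x + j y by have := jL 1 x y; rewrite !scale1r.
have [v iv vP] : exists2 v : {linear E -> Y}, isometric_embedding v & forall x, v x = j (x, 0).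
  have [||v iv vP] := @linear_of_graph _ E Y (fun x y => y = j (x, 0)).
  - split; first by rewrite -[X in j X]/(0 : W) j0.
      move=> a x _ x' _ -> ->; rewrite -jL.
      by rewrite -[_ + (x', 0)]/(a *: x + x', a *: 0 + 0) scaler0 addr0.
    by move=> x _ ->; rewrite jN /N /= normr0 addr0.
  - by apply/seteqP; split=> // x _; exists (j (x, 0)).
  - by exists v.
have svr : subspace_of (range v).
  have -> : range v = dom (fun y x => v x = y).
    by apply/seteqP; split=> [y [x _ <-]|y [x <-]]; exists x.
  apply: (@closed_graph _ _ _ (fun x y => v x = y)).
    split; first by rewrite raddf0.
      by move=> a x y x' y' <- <-; rewrite linearP.
    by move=> x y <-; rewrite iv.
  have -> : dom (fun x y => v x = y) = [set: E].
    by apply/seteqP; split=> // x _; exists (v x).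
  exact: subspaceT.
have lvr := subspace_linear svr.
pose S : set Y := range (fun r : R^o => j (0, r)).
have lS : linear_set S.
  split; first by exists 0; rewrite // -[X in j X]/(0 : W) j0.
  move=> a _ _ [r _ <-] [r' _ <-]; exists (a *: r + r') => //.
  by rewrite -jL -[_ + (0, r')]/(a *: 0 + 0, a *: r + r') scaler0 addr0.
have cvr : closure (range v) = range v by apply/esym/closure_id; case: svr.
have jE x : j x = v x.1 + j (0, x.2).
  by rewrite vP -jD -[_ + _]/(x.1 + 0, 0 + x.2) addr0 add0r; case: x.
have pv : posex_embedding v.
  split=> //; exists (closure S).
    apply: separable_subset (separable_cspan (countable1 (j (0, 1)))) _.
    apply: sub_closure_subspace; first exact: cspan_subspace.
    move=> _ [r _ <-].
    have -> : j (0, r) = r *: j (0, 1).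
      have := jL r (0, 1) 0; rewrite j0 !addr0 => <-; congr j.
      by rewrite -[RHS]/(r *: 0, r * 1) scaler0 mulr1.
    apply: (linear_setZ _ (subspace_linear (cspan_subspace _))).
    exact: sub_cspan.
  have -> : [set: Y] = closure (sumset S (range v)).
    apply/seteqP; split=> // z _; apply/closure_normP => e /(jd z)[x _ zx].
    exists (j x) => //; exists (j (0, x.2)); first by exists x.2.
    by exists (v x.1); [exists x.1|rewrite addrC -jE].
  rewrite -[in X in pushout _ _ X]cvr; apply: pushout_closure => //.
  move=> _ _ [x _ <-] [r _ <-] e e0; exists 0.
    split; first by apply: subset_closure; exact: lS.1.
    by rewrite cvr; exact: lvr.1.
  rewrite addr0 subr0 -[v x + _](jE (x, r)) jN iv jN /N /= normr0 add0r.
  by rewrite ltrDl.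
have iid : isometric_embedding (idfun : {linear E -> E}) by [].
have [w iw wv] := extE _ _ _ _ iid pv dE.
have vw : v (w (j (0, 1))) = j (0, 1) by apply: (isometric_inj iw); rewrite wv.
(* This vector has norm at least 1 by the choice of [N], yet its image v (w (j (0, 1))) - j (0, 1)
   vanishes. *)
have := jN (w (j (0, 1)), - 1); rewrite jE vw /= -jD.
rewrite -[_ + _]/(0 + 0, 1 - 1) addr0 subrr -[X in j X]/(0 : W) j0 normr0 /N /= normrN1.
by have := normr_ge0 (w (j (0, 1))); lra.
Qed.

(** * Counting the data *)

Section DataCardinality.
Variables (R : realType) (L : Type).
Let W := L -> {poly R}.

Lemma continuum_poly : [set: {poly R}] #<= cc.
Proof.
apply: (@continuum_embedding _ (seq R) (@polyseq R)); first exact: val_inj.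
exact/continuum_seq/continuum_real.
Qed.

Lemma continuum_vspan G : [set: L] #<= cc -> lspan (@level_set R L) G #<= cc.
Proof.
move=> cL; pose ev (s : seq (L * {poly R})) : W := foldr (fun ap x => x + level ap.1 ap.2) 0 s.
apply: card_le_trans (continuum_seq (continuum_prod cL continuum_poly)).
apply: card_le_trans (_ : ev @` setT #<= _); last exact: card_image_le.
apply: subset_card_le => x; elim=> [|y a s _ [l _ <-] _ [p _ <-]]; first by exists [::].
by exists ((a, p) :: l).
Qed.

(** As [r] is an arbitrary seminorm, the induction follows Horner's scheme: p -> r (p X) is again a
    seminorm and takes care of the higher coefficients, while the constant coefficient is
    approximated at a cost proportional to r 1. *)
Lemma rat_poly_dense (r : {poly R} -> R) : seminorm_on setT r -> forall p e, 0 < e ->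
  exists p' : {poly rat}, r (p - map_poly ratr p') < e.
Proof.
move=> sr p; elim/poly_ind: p r sr => [|p c IH] r sr e e0.
  exists 0; rewrite rmorph0 subr0.
  by rewrite (seminorm0 (P := setT)).
have sr' : seminorm_on setT (fun p => r (p * 'X)).
  by split=> [x y _ _|a x _]; rewrite ?mulrDl -?scalerAl; [exact: sr.1|exact: sr.2].
have e20 : 0 < e / 2 by rewrite divr_gt0.
have [p' hp'] := IH _ sr' _ e20.
have r1 : 0 <= r 1 by apply: (seminorm_ge0 (P := setT)).
have r10 : 0 < r 1 + 1 by rewrite ltr_wpDl.
have [q] := @rat_in_itvoo R c (c + e / 2 / (r 1 + 1)) ltac:(by rewrite ltrDl divr_gt0).
rewrite in_itv /= => /andP[cq qc].
exists (p' * 'X + q%:P); rewrite rmorphD rmorphM /= map_polyX map_polyC /=.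
have -> : p * 'X + c%:P - (map_poly ratr p' * 'X + (ratr q)%:P) =
    (p - map_poly ratr p') * 'X + (c - ratr q) *: 1.
  by rewrite mulrBl opprD addrACA -polyCB -mul_polyC mulr1.
apply: le_lt_trans (sr.1 _ _ I I) _; rewrite sr.2// distrC gtr0_norm ?subr_gt0//.
have : (ratr q - c) * (r 1 + 1) < e / 2 by rewrite -ltr_pdivlMr// ltrBlDl.
have : 0 < ratr q - c by rewrite subr_gt0.
by move: hp'; lra.
Qed.

Definition data_set : set (datum R L) := [set d |
  (forall n, lspan (@level_set R L) setT (d.1 n)) /\ seminorm_on setT d.2].

Let sample (q : {poly R} * {poly R} -> R) : nat -> R := fun n =>
  if unpickle n is Some (p, p') then q (map_poly ratr (p : {poly rat}), map_poly ratr (p' : {poly rat})) else 0.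

Let sample_inj q q' : seminorm_on setT q -> seminorm_on setT q' -> sample q = sample q' -> q = q'.
Proof.
move=> sq sq' qq'; apply/funext => -[x y].
have agree p p' : q (map_poly ratr p, map_poly ratr p') = q' (map_poly ratr p, map_poly ratr p').
  by have := congr1 (fun h => h (pickle (p, p'))) qq'; rewrite /sample pickleK.
have pairD (h : {poly R} * {poly R} -> R) : seminorm_on setT h -> seminorm_on setT (fun p => h (p, 0))
    /\ seminorm_on setT (fun p => h (0, p)).
  move=> sh; split; split=> [u v _ _|a u _].
  - by have := sh.1 (u, 0) (v, 0) I I; rewrite -[_ + (v, 0)]/(u + v, 0 + 0) addr0.
  - by have := sh.2 a (u, 0) I; rewrite -[_ *: (u, 0)]/(a *: u, a *: 0) scaler0.
  - by have := sh.1 (0, u) (0, v) I I; rewrite -[_ + (0, v)]/(0 + 0, u + v) addr0.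
  - by have := sh.2 a (0, u) I; rewrite -[_ *: (0, u)]/(a *: 0, a *: u) scaler0.
have sumS (g h : {poly R} -> R) : seminorm_on setT g -> seminorm_on setT h ->
    seminorm_on setT (fun p => g p + h p).
  move=> sg sh; split=> [u v _ _|a u _].
    by have := sg.1 u v I I; have := sh.1 u v I I; lra.
  by rewrite sg.2// sh.2// mulrDr.
have key (h : {poly R} * {poly R} -> R) u v : seminorm_on setT h -> `|h (x, y) - h (u, v)| <= h (x - u, 0) + h (0, y - v).
  move=> sh; apply: le_trans (seminorm_dist (P := setT) _ sh I I) _ => //.
  have := sh.1 (x - u, 0) (0, y - v) I I.
  by rewrite -[_ + (0, _)]/(x - u + 0, 0 + (y - v)) addr0 add0r.
have ge0 (h : {poly R} * {poly R} -> R) z : seminorm_on setT h -> 0 <= h z.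
  by move=> sh; apply: (seminorm_ge0 (P := setT)).
apply/eqP; rewrite -subr_eq0 -normr_eq0 eq_le normr_ge0 andbT; apply/ler_addgt0Pr => e e0.
have e20 : 0 < e / 2 by rewrite divr_gt0.
(* Approximation for the sum of the two seminorms gives one rational polynomial that serves [q] and
   [q'] at once. *)
have [p hp] := rat_poly_dense (sumS _ _ (pairD q sq).1 (pairD q' sq').1) x e20.
have [p' hp'] := rat_poly_dense (sumS _ _ (pairD q sq).2 (pairD q' sq').2) y e20.
have := key q (map_poly ratr p) (map_poly ratr p') sq.
have := key q' (map_poly ratr p) (map_poly ratr p') sq'.
rewrite agree; set m := q' (map_poly ratr p, _) => h1 h2.
have := ler_normD (q (x, y) - m) (m - q' (x, y)).
by rewrite addrA subrK (distrC m); move: hp hp' h1 h2; lra.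
Qed.

Lemma continuum_data : [set: L] #<= cc -> data_set #<= cc.
Proof.
move=> /(continuum_vspan setT)/card_le_inj[f [_ finj]].
apply: card_le_trans (continuum_prod (continuum_seqs (card_lexx cc)) (continuum_seqs (continuum_real R))).
apply: (@card_le_of_inj _ _ _ _ (fun d : datum R L => (fun n => f (d.1 n), sample d.2))) => //.
move=> [w q] [w' q'] /= [wV sq] [wV' sq'] [ww' qq']; congr (_, _); last exact: sample_inj.
by apply/funext => n; apply: finj => //; exact: (congr1 (fun h => h n) ww').
Qed.

(** An injection of c x c into c provides, for each datum, c distinct indices at which it is
    decoded. *)
Lemma exists_decoding : [set: L] #<= cc ->
  exists dec : continuum -> datum R L, forall d, data_set d -> cc #<= [set t | dec t = d].
Proof.
move=> /continuum_data/card_le_inj[f [_ finj]].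
have /card_le_inj[g [_ ginj]] := continuum_prod (card_lexx cc) (card_lexx cc).
have /choice[dec decP] t : exists d, forall d' s, data_set d' -> t = g (f d', s) -> d = d'.
  have [[d [s [Dd ts]]]|n] := pselect (exists d s, data_set d /\ t = g (f d, s)); last first.
    by exists (fun=> 0, fun=> 0) => d s Dd ts; case: n; exists d, s.
  exists d => d' s' Dd'; rewrite ts => /ginj; move=> /(_ I I) [fd _].
  exact: finj.
exists dec => d Dd; apply: (@card_le_of_inj _ _ _ _ (fun s => g (f d, s))).
  by move=> s _ /=; exact: decP Dd erefl.
by move=> s s' _ _ /ginj; move=> /(_ I I)[].
Qed.
End DataCardinality.

(** The approximating points must lie in [Z] itself, not in its closure: a datum consists of vectors
    of the tower, so only their images may be used. *)
Lemma separable_approximation (R : realType) (E : completeNormedModType R) (A Z : set E) :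
  separable_set A -> A `<=` closure Z -> Z !=set0 ->
  exists z : nat -> E, (forall n, Z (z n)) /\ A `<=` closure (range z).
Proof.
move=> [D [cD DA AD]] AZ [z0 Zz0].
have /choice[pick pickP] (p : E * nat) : exists z, Z z /\ (D p.1 -> `|p.1 - z| < 2^-1 ^+ p.2).
  have [/DA/AZ/closure_normP clp|nD] := pselect (D p.1); last by exists z0.
  have [|z Zz pz] := clp (2^-1 ^+ p.2); first by rewrite exprn_gt0// invr_gt0.
  by exists z.
have [e eP] := countable_range (point : E * nat) (countableX cD (countableP [set: nat])).
exists (fun n => pick (e n)); split=> [n|]; first exact: (pickP _).1.
apply: subset_trans AD _.
rewrite [X in _ `<=` X](closure_id _).1; last exact: closed_closure.
apply: closureS => d Dd; apply/closure_normP => r /half_expn_lt[n hn].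
have [k ek] := eP (d, n) (conj Dd I).
exists (pick (e k)); first by exists k.
by apply: lt_trans hn; rewrite ek; exact: (pickP (d, n)).2.
Qed.

Lemma separable_image (R : realType) (X E : completeNormedModType R) (u : {linear X -> E}) (A : set X) :
  isometric_embedding u -> separable_set A -> separable_set (u @` A).
Proof.
move=> iu [D [cD DA AD]]; exists (u @` D); split.
- by apply: sub_countable cD; exact: card_image_le.
- by move=> _ [x /DA Ax <-]; exists x.
- move=> _ [x /AD/closure_normP clx <-]; apply/closure_normP => e /clx[d Dd xd].
  by exists (u d); [exists d|rewrite isometric_dist].
Qed.

(** The added top indexes the whole completed space; the decoded data all sit at indices [Some t]
    strictly below it. *)
Definition le_option (T : Type) (le : rel T) : rel (option T) := fun x y =>
  match x, y with
  | _, None => true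
  | None, Some _ => false
  | Some a, Some b => le a b
  end.

Lemma wo_option (T : Type) (le : rel T) :
  wochoice.well_order le -> wochoice.well_order (le_option le).
Proof.
move=> wo A [x Ax].
have [[t At]|nA] := pselect (exists t, Some t \in A).
  have [|t0 At0 tmin] := wo_minimum wo (A := [set t | Some t \in A]); first by exists t.
  exists (Some t0); split; first by split=> // -[s|] //= As; exact: tmin.
  move=> [s|] [As smin]; last by have := smin _ At0.
  by congr Some; apply: (wo_antisymmetric wo); [exact: tmin|exact: (smin (Some t0))].
have onlyN y : y \in A -> y = None by case: y => // t At; case: nA; exists t.
exists None; split; first by split; [rewrite -(onlyN x Ax)|move=> y /onlyN ->].
by move=> y [/onlyN ->].
Qed.

Theorem tightly_filtered_exists (R : realType) : regular_cardinal continuum ->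
  exists E : completeNormedModType R,
    [/\ has_dens E cc, tightly_sigma_filtered E & extension_property E].
Proof.
move=> hc; have [le0 ile] := exists_initial_well_order continuum.
pose L := option continuum; pose le := le_option le0.
have wo : wochoice.well_order le := wo_option ile.1.
have topP : is_greatest le None by case.
have cL : [set: L] #<= cc := continuum_option (card_lexx cc).
have [dec decP] := exists_decoding R cL.
pose decode (a : L) : datum R L := if a is Some t then dec t else (fun=> 0, fun=> 0).
have [G GP] := tower_exists wo decode.
have [E [j [jL jN jd]]] := seminorm_completion (linear_vspan R (below le None)) (GP None).1.
(* A point is the limit of a sequence of vectors with bounded supports. By regularity countably many
   bounds have a common bound below the top, so the top stage is the union of the proper ones,
   without a further closure. *)
have cover x : exists t, stage le j (Some t) x.
  have /choice[f fP] n : exists f, lspan (@level_set R L) (below le None) f /\ `|x - j f| < 2^-1 ^+ n.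
    by have [|f ? ?] := jd x (2^-1 ^+ n); [rewrite exprn_gt0// invr_gt0|exists f].
  have /choice[s sP] n : exists s, lspan (@level_set R L) [set c | le c (Some s)] (f n).
    have [->|[[s|] sb fs]] := lspan_max wo (fP n).1; last by [].
      by exists point; exact: lspan0.
    by exists s; apply: lspanW fs => c [].
  have [t tP] := small_bounded hc ile (small_countable (sub_countable (card_image_le s setT) (countableP _))).
  exists t; apply/closure_normP => e /half_expn_lt[n hn].
  exists (j (f n)); last exact: lt_trans (fP n).2 hn.
  exists (f n) => //; apply: lspanW (sP n); apply: upto_below => //.
  by apply: tP; exists n.
have sS a := stage_subspace wo topP GP jL jN a.
have ext : extension_property E.
  move=> X Y u v iu [iv [S sepS po]] [D /dense_normP dD sD].
  have [t ut] : exists t, forall x, stage le j (Some t) (u x).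
    have /choice[s sP] x := cover (u x).
    have [t tP] := small_bounded hc ile (small_image s sD).
    exists t => x; apply: (subspace_closureP (sS _)) => e /(dD x)[d Dd xd].
    exists (u d); last by rewrite isometric_dist.
    have st : le (Some (s d)) (Some t) by apply: (wo_ltW wo); apply: tP; exists d.
    exact: (stageW wo st) (sP d).
  have lS : linear_set S by case: po => -[_ /subspace_linear].
  have [|sg [Ssg sgd]] := separable_approximation sepS (@subset_closure _ S).
    by exists 0; exact: lS.1.
  have sg_dense : S `<=` closure (range (lincomb idfun sg)).
    apply: subset_trans sgd (closureS _) => _ [n _ <-].
    by exists 'X^n => //; exact: lincombX.
  have sepA : separable_set (u @` (v @^-1` S)).
    apply: separable_image => //.
    have -> : v @^-1` S = v @^-1` (S `&` range v).
      by apply/seteqP; split=> x /=; [split=> //; exists x|case].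
    apply: (separable_preimage iv); last exact: subIsetr.
    by apply: separable_subset sepS _; exact: subIsetl.
  have [||z [zV zd]] := separable_approximation sepA (Z := j @` lspan (@level_set R L) (below le (Some t))).
  - by move=> _ [x _ <-]; exact: ut.
  - by exists (j 0), 0; first exact: lspan0.
  have /choice[w wP] n : exists f, lspan (@level_set R L) (below le (Some t)) f /\ j f = z n.
    by have [f ? ?] := zV n; exists f.
  have wd : u @` (v @^-1` S) `<=` closure (range (fun n => j (w n))).
    by apply: subset_trans zd (closureS _) => _ [n _ <-]; exists n => //; exact: (wP n).2.
  pose d : datum R L := (w, gap j u v S sg w).
  have Dd : data_set d.
    split=> [n|]; first by apply: lspanW (wP n).1.
    exact: (gap_seminorm wo topP GP jL jN u sg po (fun n => (wP n).1)).
  have [b db tb] := small_unboundedP ile t (decP d Dd).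
  exact: (level_extension wo topP GP jL jN iu iv po Ssg sg_dense ut (fun n => (wP n).1) wd
    (isT : below le None (Some b)) (tb : le (Some t) (Some b)) db).
have cE : [set: E] #<= cc.
  apply: (@card_le_dense _ _ (j @` lspan (@level_set R L) (below le None))).
    by apply/dense_normP => x e /(jd x)[f Lf xf]; exists (j f) => //; exists f.
  by apply: card_le_trans (card_image_le _ _) _; exact: continuum_vspan.
(* A dense set not of full cardinality would give the space density below c, which the extension
   property excludes. *)
have nD (D : set E) : dense D -> cc #<= D.
  move=> dD; apply: contrapT => nD; apply: (extension_not_dens_lt ext).
  by exists D => //; split=> //; apply: card_le_trans (card_leT D) cE.
have dT : dense [set: E] by apply/dense_normP => x e e0; exists x; rewrite // subrr normr0.
exists E; split=> //; last first.
  exact: (stage_tightly_filtered wo topP GP jL jN jd).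
split=> //; exists [set: E] => //.
by rewrite card_eq_le cE nD.
Qed.

Theorem theorem16 (R : realType) (hc : regular_cardinal continuum) :
  exists E : completeNormedModType R,
    [/\ has_dens E [set: continuum],
        tightly_sigma_filtered E
      & extension_property E] /\
    forall E' : completeNormedModType R,
      has_dens E' [set: continuum] ->
      tightly_sigma_filtered E' ->
      extension_property E' ->
      isometric E E'.
Proof.
have [E [dE tE xE]] := tightly_filtered_exists R hc.
exists E; split; first by split.
by move=> E' dE' tE' xE'; exact: (tightly_filtered_unique hc).
Qed.
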